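(* Let $R$ be a Dedekind domain with fraction field $K$. Then the following three conditions are equivalent: (i) $\mathcal C_R=\operatorname{Cot}(R)$; (ii) $|\operatorname{Spec}R|\leq\aleph_0$; (iii) $K$ is at most countably generated as an $R$-module. Moreover, $\operatorname{Cot}(R)\subseteq\mathcal C_R$ for every Dedekind domain $R$.
   Context: Fields are allowed as Dedekind domains. For a ring $R$: $\mathcal{L}_R$ is the class of all $R$-modules isomorphic to an inverse limit $\varprojlim_{n<\omega}(I_n,p_n)$ of a tower indexed by $\omega$ in which every $I_n$ is an injective $R$-module and every connecting map $p_n:I_{n+1}\to I_n$ is a surjective $R$-linear map. $\mathcal{C}_R$ is the class of all $R$-modules isomorphic to a direct summand of some $L\in\mathcal{L}_R$. An $R$-module $C$ is cotorsion (in the sense of Enochs) if $\operatorname{Ext}^1_R(F,C)=0$ for every flat $R$-module $F$; $\operatorname{Cot}(R)$ is the class of cotorsion $R$-modules. $\operatorname{Spec}R$ is the set of prime ideals of $R$. ''At most countably generated'' means generated by a finite or countably infinite set. *)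

(* Defs.v *)
From HB Require Import structures.
From mathcomp Require Import all_boot all_order all_algebra.
From mathcomp Require Import generic_quotient.
From mathcomp Require Import all_classical.

Set Implicit Arguments.
Unset Strict Implicit.
Unset Printing Implicit Defensive.

Import GRing.Theory.
Local Open Scope ring_scope.
Local Open Scope quotient_scope.
Local Open Scope classical_set_scope.

Section Modules.
Variable R : comNzRingType.

Definition lmod_iso (M N : lmodType R) : Prop :=
  exists f : {linear M -> N}, bijective f.

Definition injective_module (I : lmodType R) : Prop :=
  forall (A B : lmodType R) (i : {linear A -> B}) (f : {linear A -> I}),
    injective i -> exists g : {linear B -> I}, forall a, g (i a) = f a.

Definition projective_module (P : lmodType R) : Prop :=
  forall (A B : lmodType R) (p : {linear A -> B}) (f : {linear P -> B}),
    (forall b, exists a, p a = b) ->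
    exists g : {linear P -> A}, forall x, p (g x) = f x.

Definition exact_at (A B C : lmodType R)
    (f : {linear A -> B}) (g : {linear B -> C}) : Prop :=
  forall b, g b = 0 <-> exists a, f a = b.

(* ... -> res 2 -> res 1 -> res 0 -> M -> 0 *)
Record projective_resolution (M : lmodType R) := ProjectiveResolution {
  res :> nat -> lmodType R;
  diff : forall n, {linear res n.+1 -> res n};
  aug : {linear res 0%N -> M};
  res_projective : forall n, projective_module (res n);
  res_exact : forall n, exact_at (diff n.+1) (diff n);
  res_exact0 : exact_at (diff 0) aug;
  aug_surj : forall m, exists x, aug x = m
}.

(* Ext^1_R(M, N) = 0, i.e., H^1(Hom_R(P, N)) = 0 for every projective
   resolution P of M: every 1-cocycle is a 1-coboundary. *)
Definition Ext1_eq0 (M N : lmodType R) : Prop :=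
  forall (P : projective_resolution M) (f : {linear P 1%N -> N}),
    (forall x, f (diff P 1 x) = 0) ->
    exists g : {linear P 0%N -> N}, forall x, f x = g (diff P 0 x).

End Modules.

(* The sequence [:: (a_1, b_1); ...; (a_n, b_n)] stands for the formal sum of
   the a_i (x) b_i.  Formal opposites are not needed: (- a) (x) b is already an
   opposite of a (x) b. *)
Section TensorProduct.
Variables (R : comNzRingType) (A B : lmodType R).

Inductive tens_rel : seq (A * B) -> seq (A * B) -> Prop :=
| tens_refl s : tens_rel s s
| tens_sym s t : tens_rel s t -> tens_rel t s
| tens_trans s t u : tens_rel s t -> tens_rel t u -> tens_rel s u
| tens_cat s s' t t' :
    tens_rel s s' -> tens_rel t t' -> tens_rel (s ++ t) (s' ++ t')
| tens_catC s t : tens_rel (s ++ t) (t ++ s)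
| tens_0l b : tens_rel [:: (0, b)] [::]
| tens_Dl a a' b : tens_rel [:: (a + a', b)] [:: (a, b); (a', b)]
| tens_Dr a b b' : tens_rel [:: (a, b + b')] [:: (a, b); (a, b')]
| tens_Z r a b : tens_rel [:: (r *: a, b)] [:: (a, r *: b)].

Definition tens_relb : rel (seq (A * B)) := fun s t => `[< tens_rel s t >].

Lemma tens_relb_refl : reflexive tens_relb.
Proof. by move=> s; apply/asboolP; exact: tens_refl. Qed.

Lemma tens_relb_sym : symmetric tens_relb.
Proof. by move=> s t; apply/asboolP/asboolP; exact: tens_sym. Qed.

Lemma tens_relb_trans : transitive tens_relb.
Proof.
by move=> t s u /asboolP st /asboolP tu; apply/asboolP; exact: tens_trans st tu.
Qed.

Canonical tens_equiv :=
  EquivRel tens_relb tens_relb_refl tens_relb_sym tens_relb_trans.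

Definition tensor := {eq_quot tens_equiv}.
HB.instance Definition _ := Choice.on tensor.
HB.instance Definition _ := EqQuotient.on tensor.

Lemma tens_piW (P : tensor -> Prop) : (forall s, P (\pi_tensor s)) -> forall x, P x.
Proof. by move=> Ppi x; rewrite -[x]reprK. Qed.

Lemma tens_eqP s t : \pi_tensor s = \pi_tensor t <-> tens_rel s t.
Proof. by split=> [/eqmodP /asboolP | st]; last by apply/eqmodP/asboolP. Qed.

Definition tens_scale_seq (r : R) : seq (A * B) -> seq (A * B) :=
  map (fun p => (r *: p.1, p.2)).

Lemma tens_scale_rel r s t :
  tens_rel s t -> tens_rel (tens_scale_seq r s) (tens_scale_seq r t).
Proof.
elim=> {s t} /=.
- by move=> s; exact: tens_refl.
- by move=> s t _; exact: tens_sym.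
- by move=> s t u _ st _ tu; exact: tens_trans st tu.
- by move=> s s' t t' _ ss' _ tt'; rewrite /tens_scale_seq !map_cat;
    exact: tens_cat.
- by move=> s t; rewrite /tens_scale_seq !map_cat; exact: tens_catC.
- by move=> b; rewrite scaler0; exact: tens_0l.
- by move=> a a' b; rewrite scalerDr; exact: tens_Dl.
- by move=> a b b'; exact: tens_Dr.
- by move=> k a b; rewrite scalerA mulrC -scalerA; exact: tens_Z.
Qed.

Definition tens_zero : tensor := \pi_tensor [::].
Definition tens_add (x y : tensor) : tensor := \pi_tensor (repr x ++ repr y).
Definition tens_scale (r : R) (x : tensor) : tensor :=
  \pi_tensor (tens_scale_seq r (repr x)).
Definition tens_opp : tensor -> tensor := tens_scale (-1).

Lemma tens_repr s : tens_rel (repr (\pi_tensor s)) s.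
Proof. by apply/tens_eqP; rewrite reprK. Qed.

Lemma tens_addE s t :
  tens_add (\pi_tensor s) (\pi_tensor t) = \pi_tensor (s ++ t).
Proof.
rewrite /tens_add; apply/tens_eqP.
by apply: tens_cat; exact: tens_repr.
Qed.

Lemma tens_scaleE r s :
  tens_scale r (\pi_tensor s) = \pi_tensor (tens_scale_seq r s).
Proof.
rewrite /tens_scale; apply/tens_eqP; apply: tens_scale_rel.
exact: tens_repr.
Qed.

Lemma tens_addA : associative tens_add.
Proof.
elim/tens_piW=> s; elim/tens_piW=> t; elim/tens_piW=> u.
by rewrite !tens_addE catA.
Qed.

Lemma tens_addC : commutative tens_add.
Proof.
elim/tens_piW=> s; elim/tens_piW=> t; rewrite !tens_addE.
by apply/tens_eqP; exact: tens_catC.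
Qed.

Lemma tens_add0 : left_id tens_zero tens_add.
Proof. by elim/tens_piW=> s; rewrite tens_addE. Qed.

Lemma tens_scaleDl x r k :
  tens_scale (r + k) x = tens_add (tens_scale r x) (tens_scale k x).
Proof.
elim/tens_piW: x => s; rewrite !tens_scaleE tens_addE; apply/tens_eqP.
elim: s => [|[a b] s IH] /=; first exact: tens_refl.
apply: (tens_trans (t := [:: (r *: a, b); (k *: a, b)] ++
  (tens_scale_seq r s ++ tens_scale_seq k s))).
  rewrite -[X in tens_rel X]/([:: ((r + k) *: a, b)] ++ _) scalerDl.
  by apply: tens_cat IH; exact: tens_Dl.
rewrite /=; apply: (tens_cat (s := [:: _]) (s' := [:: _])); first exact: tens_refl.
rewrite -[X in tens_rel X]/(([:: (k *: a, b)] ++ _) ++ _).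
rewrite -[X in tens_rel _ X]/(_ ++ ([:: (k *: a, b)] ++ _)) catA.
by apply: tens_cat; [exact: tens_catC | exact: tens_refl].
Qed.

Lemma tens_scale0 x : tens_scale 0 x = tens_zero.
Proof.
elim/tens_piW: x => s; rewrite tens_scaleE; apply/tens_eqP.
elim: s => [|[a b] s IH] /=; first exact: tens_refl.
rewrite scale0r; exact: (tens_cat (s := [:: _]) (s' := [::]) (tens_0l b) IH).
Qed.

Lemma tens_scale1 : left_id 1 tens_scale.
Proof.
elim/tens_piW=> s; rewrite tens_scaleE; congr \pi_tensor.
by elim: s => [|[a b] s IH] //=; rewrite scale1r IH.
Qed.

Lemma tens_addN : left_inverse tens_zero tens_opp tens_add.
Proof.
move=> x; rewrite /tens_opp -[X in tens_add _ X]tens_scale1.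
by rewrite -tens_scaleDl addNr tens_scale0.
Qed.

HB.instance Definition _ :=
  GRing.isZmodule.Build tensor tens_addA tens_addC tens_add0 tens_addN.

Lemma tens_piD s t : \pi_tensor s + \pi_tensor t = \pi_tensor (s ++ t).
Proof. exact: tens_addE. Qed.

Lemma tens_scaleA r k x : tens_scale r (tens_scale k x) = tens_scale (r * k) x.
Proof.
elim/tens_piW: x => s; rewrite !tens_scaleE; congr \pi_tensor.
by elim: s => [|[a b] s IH] //=; rewrite scalerA IH.
Qed.

Lemma tens_scaleDr : right_distributive tens_scale +%R.
Proof.
move=> r; elim/tens_piW=> s; elim/tens_piW=> t.
by rewrite !(tens_piD, tens_scaleE) /tens_scale_seq map_cat.
Qed.

HB.instance Definition _ := GRing.Zmodule_isLmodule.Build R tensor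
  tens_scaleA tens_scale1 tens_scaleDr tens_scaleDl.

Lemma tens_piZ r s : r *: \pi_tensor s = \pi_tensor (tens_scale_seq r s).
Proof. exact: tens_scaleE. Qed.

Definition tens (a : A) (b : B) : tensor := \pi_tensor [:: (a, b)].

Lemma tens_piE s : \pi_tensor s = \sum_(p <- s) tens p.1 p.2.
Proof.
elim: s => [|[a b] s IH]; first by rewrite big_nil.
by rewrite big_cons -IH tens_piD.
Qed.

Lemma tensor_universal (C : lmodType R) (h : A -> B -> C) :
  (forall a, linear (h a)) -> (forall b, linear (h^~ b)) ->
  exists2 g : {linear tensor -> C}, forall a b, g (tens a b) = h a b &
    forall f : {linear tensor -> C}, (forall a b, f (tens a b) = h a b) ->
      f =1 g.
Proof.
move=> hr hl.
pose ev (s : seq (A * B)) := \sum_(p <- s) h p.1 p.2.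
have hDl b a a' : h (a + a') b = h a b + h a' b.
  by have := hl b 1 a a'; rewrite !scale1r.
have h0l b : h 0 b = 0.
  by apply: (addrI (h 0 b)); rewrite -hDl !addr0.
have hDr a b b' : h a (b + b') = h a b + h a b'.
  by have := hr a 1 b b'; rewrite !scale1r.
have h0r a : h a 0 = 0.
  by apply: (addrI (h a 0)); rewrite -hDr !addr0.
have hZl r a b : h (r *: a) b = r *: h a b.
  by have := hl b r a 0; rewrite h0l !addr0.
have hZr r a b : h a (r *: b) = r *: h a b.
  by have := hr a r b 0; rewrite h0r !addr0.
have evP s t : tens_rel s t -> ev s = ev t.
  elim=> {s t} //.
  - by move=> s t u _ -> _ ->.
  - by move=> s s' t t' _ e _ e'; rewrite /ev !big_cat -!/(ev _) e e'.
  - by move=> s t; rewrite /ev !big_cat /= addrC.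
  - by move=> b; rewrite /ev big_seq1 big_nil h0l.
  - by move=> a a' b; rewrite /ev !big_cons !big_nil !addr0 hDl.
  - by move=> a b b'; rewrite /ev !big_cons !big_nil !addr0 hDr.
  - by move=> r a b; rewrite /ev !big_seq1 /= hZl hZr.
pose g (x : tensor) := ev (repr x).
have gE s : g (\pi_tensor s) = ev s by apply: evP; exact: tens_repr.
have g_lin : linear g.
  move=> r; elim/tens_piW=> s; elim/tens_piW=> t.
  rewrite tens_piZ tens_piD !gE.
  rewrite /ev big_cat big_map scaler_sumr; congr (_ + _).
  by apply: eq_bigr => p _; rewrite /= hZl.
pose gL := HB.pack_for {linear tensor -> C} g
  (GRing.isLinear.Build R tensor C *:%R g g_lin).
exists gL => [a b|f fE]; first by rewrite /= gE /ev big_seq1.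
elim/tens_piW=> s; rewrite /= gE tens_piE linear_sum.
by apply: eq_bigr => p _; rewrite fE.
Qed.

End TensorProduct.

Section Flat.
Variable R : comNzRingType.

Definition tensor_map_fun (A B F : lmodType R) (f : {linear A -> B})
    (x : tensor A F) : tensor B F :=
  \pi_(tensor B F) [seq (f p.1, p.2) | p <- repr x].

Lemma tensor_map_rel (A B F : lmodType R) (f : {linear A -> B})
    (s t : seq (A * F)) : tens_rel s t ->
  tens_rel [seq (f p.1, p.2) | p <- s] [seq (f p.1, p.2) | p <- t].
Proof.
elim=> {s t} /=.
- by move=> s; exact: tens_refl.
- by move=> s t _; exact: tens_sym.
- by move=> s t u _ st _ tu; exact: tens_trans st tu.
- by move=> s s' t t' _ ss' _ tt'; rewrite !map_cat; exact: tens_cat.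
- by move=> s t; rewrite !map_cat; exact: tens_catC.
- by move=> b; rewrite linear0; exact: tens_0l.
- by move=> a a' b; rewrite linearD; exact: tens_Dl.
- by move=> a b b'; exact: tens_Dr.
- by move=> k a b; rewrite linearZ; exact: tens_Z.
Qed.

Lemma tensor_map_piE (A B F : lmodType R) (f : {linear A -> B})
    (s : seq (A * F)) :
  tensor_map_fun f (\pi_(tensor A F) s) =
  \pi_(tensor B F) [seq (f p.1, p.2) | p <- s].
Proof.
rewrite /tensor_map_fun; apply/tens_eqP; apply: tensor_map_rel.
exact: tens_repr.
Qed.

Lemma tensor_map_linear (A B F : lmodType R) (f : {linear A -> B}) :
  linear (@tensor_map_fun A B F f).
Proof.
move=> r; elim/tens_piW=> s; elim/tens_piW=> t.
rewrite tens_piZ tens_piD !tensor_map_piE tens_piZ tens_piD.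
rewrite map_cat /tens_scale_seq -!map_comp; congr (\pi_(tensor B F) (_ ++ _)).
by apply: eq_map => p /=; rewrite linearZ.
Qed.

HB.instance Definition _ (A B F : lmodType R) (f : {linear A -> B}) :=
  GRing.isLinear.Build R (tensor A F) (tensor B F) *:%R (@tensor_map_fun A B F f)
    (tensor_map_linear f).

Definition tensor_map (A B F : lmodType R) (f : {linear A -> B}) :
  {linear tensor A F -> tensor B F} := @tensor_map_fun A B F f.

Lemma tensor_mapE (A B F : lmodType R) (f : {linear A -> B}) a x :
  @tensor_map A B F f (tens a x) = tens (f a) x.
Proof. exact: tensor_map_piE. Qed.

Definition flat (F : lmodType R) : Prop :=
  forall (A B : lmodType R) (f : {linear A -> B}),
    injective f -> injective (@tensor_map A B F f).

Definition cotorsion (C : lmodType R) : Prop :=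
  forall F : lmodType R, flat F -> Ext1_eq0 F C.

End Flat.

Section InverseLimit.
Variables (R : comNzRingType) (I : nat -> lmodType R).
Variable p : forall n, {linear I n.+1 -> I n}.

Record invlim := InvLim {
  coord : forall n, I n;
  coordP : forall n, p n (coord n.+1) = coord n
}.

HB.instance Definition _ := gen_eqMixin invlim.
HB.instance Definition _ := gen_choiceMixin invlim.

Lemma invlim_eqP (x y : invlim) : (forall n, coord x n = coord y n) -> x = y.
Proof.
case: x y => [x xP] [y yP] /= xy.
have e : x = y by apply: functional_extensionality_dep.
by move: xP yP; rewrite e => xP yP; congr InvLim; exact: Prop_irrelevance.
Qed.

Lemma invlim_addP (x y : invlim) n :
  p n (coord x n.+1 + coord y n.+1) = coord x n + coord y n.
Proof. by rewrite linearD !coordP. Qed.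

Lemma invlim_oppP (x : invlim) n : p n (- coord x n.+1) = - coord x n.
Proof. by rewrite linearN coordP. Qed.

Lemma invlim_scaleP r (x : invlim) n :
  p n (r *: coord x n.+1) = r *: coord x n.
Proof. by rewrite linearZ coordP. Qed.

Definition invlim_zero := @InvLim (fun n => 0) (fun n => linear0 (p n)).
Definition invlim_add x y := InvLim (invlim_addP x y).
Definition invlim_opp x := InvLim (invlim_oppP x).
Definition invlim_scale r x := InvLim (invlim_scaleP r x).

Lemma invlim_addA : associative invlim_add.
Proof. by move=> x y z; apply: invlim_eqP => n; exact: addrA. Qed.

Lemma invlim_addC : commutative invlim_add.
Proof. by move=> x y; apply: invlim_eqP => n; exact: addrC. Qed.

Lemma invlim_add0 : left_id invlim_zero invlim_add.
Proof. by move=> x; apply: invlim_eqP => n; exact: add0r. Qed.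

Lemma invlim_addN : left_inverse invlim_zero invlim_opp invlim_add.
Proof. by move=> x; apply: invlim_eqP => n; exact: addNr. Qed.

HB.instance Definition _ := GRing.isZmodule.Build invlim
  invlim_addA invlim_addC invlim_add0 invlim_addN.

Lemma invlim_scaleA r k x :
  invlim_scale r (invlim_scale k x) = invlim_scale (r * k) x.
Proof. by apply: invlim_eqP => n; exact: scalerA. Qed.

Lemma invlim_scale1 : left_id 1 invlim_scale.
Proof. by move=> x; apply: invlim_eqP => n; exact: scale1r. Qed.

Lemma invlim_scaleDr : right_distributive invlim_scale +%R.
Proof. by move=> r x y; apply: invlim_eqP => n; exact: scalerDr. Qed.

Lemma invlim_scaleDl x r k :
  invlim_scale (r + k) x = invlim_scale r x + invlim_scale k x.
Proof. by apply: invlim_eqP => n; exact: scalerDl. Qed.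

HB.instance Definition _ := GRing.Zmodule_isLmodule.Build R invlim
  invlim_scaleA invlim_scale1 invlim_scaleDr invlim_scaleDl.

End InverseLimit.

Section Classes.
Variable R : comNzRingType.

Definition classL (L : lmodType R) : Prop :=
  exists (I : nat -> lmodType R) (p : forall n, {linear I n.+1 -> I n}),
    [/\ forall n, injective_module (I n),
        forall n y, exists x, p n x = y &
        lmod_iso L (invlim p)].

Definition classC (C : lmodType R) : Prop :=
  exists L D : lmodType R, classL L /\ lmod_iso L (C * D)%type.

Definition countably_generated (M : lmodType R) : Prop :=
  exists X : set M, countable X /\
    forall m, exists s : seq (R * M),
      (forall q, q \in s -> X q.2) /\ m = \sum_(q <- s) q.1 *: q.2.

End Classes.

(* idealr_closed I requires 1 \notin I; nothing is lost here, since the unit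
   ideal is always finitely generated. *)
Definition noetherian (R : comNzRingType) : Prop :=
  forall I : {pred R}, idealr_closed I ->
    exists s : seq R, forall x, x \in I <->
      exists c : 'I_(size s) -> R, x = \sum_(i < size s) c i * s`_i.

Definition Spec (R : comNzRingType) : set {pred R} :=
  [set p | idealr_closed p /\ prime_idealr_closed p].
Arguments Spec : clear implicits.

Definition maximal_ideal (R : comNzRingType) (m : {pred R}) : Prop :=
  idealr_closed m /\
  forall J : {pred R}, idealr_closed J -> {subset m <= J} -> J =i m.

Definition integrally_closed (R : idomainType) : Prop :=
  forall z : {fraction R}, integralOver (@FracField.tofrac R) z ->
    exists r, z = FracField.tofrac r.

(* Only nonzero primes have to be maximal, so a field is a Dedekind domain. *)
Definition dedekind (R : idomainType) : Prop :=
  [/\ noetherian R, integrally_closed R &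
      forall p : {pred R}, Spec R p -> (exists2 x, x \in p & x != 0) ->
        maximal_ideal p].

Section FractionModule.
Variable R : idomainType.

Definition frac_module : Type := {fraction R}.
HB.instance Definition _ := GRing.Zmodule.on frac_module.

Definition frac_scale (r : R) (x : frac_module) : frac_module :=
  (FracField.tofrac r : {fraction R}) * x.

Lemma frac_scaleA r k x : frac_scale r (frac_scale k x) = frac_scale (r * k) x.
Proof. by rewrite /frac_scale rmorphM mulrA. Qed.

Lemma frac_scale1 : left_id 1 frac_scale.
Proof. by move=> x; rewrite /frac_scale rmorph1 mul1r. Qed.

Lemma frac_scaleDr : right_distributive frac_scale +%R.
Proof. by move=> r x y; exact: mulrDr. Qed.

Lemma frac_scaleDl x r k : frac_scale (r + k) x = frac_scale r x + frac_scale k x.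
Proof. by rewrite /frac_scale rmorphD; exact: mulrDl. Qed.

HB.instance Definition _ := GRing.Zmodule_isLmodule.Build R frac_module
  frac_scaleA frac_scale1 frac_scaleDr frac_scaleDl.

End FractionModule.

(* Main.v *)
From HB Require Import structures.
Require Import Defs.
From mathcomp Require Import all_boot all_order all_algebra.
From mathcomp Require Import generic_quotient finmap all_classical.

Set Implicit Arguments.
Unset Strict Implicit.
Unset Printing Implicit Defensive.

Import GRing.Theory.
Local Open Scope ring_scope.
Local Open Scope quotient_scope.
Local Open Scope classical_set_scope.

(** Throughout, K is the fraction field of R and V stands for a torsion-free
    divisible module, i.e. a K-vector space.

    Over a Dedekind domain nonzero ideals are invertible, so divisible modules
    are injective (divisible_extends) and every quotient of an injective module
    is injective.  Consequently C is cotorsion if and only if Ext^1(V, C) = 0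
    for all V: on the one hand V is flat (torsion_free_divisible_flat), on the
    other hand a flat module F is torsion-free and embeds into K^(F)
    (torsion_free_embedding), and Ext^1(K^(F), C) maps onto Ext^1(F, C) because
    Ext^2 vanishes.  The condition on the V is called Matlis_cotorsion below
    and is phrased as a lifting property along 0 -> C -> E -> E' -> 0 with E
    divisible.

    Cotorsion modules lie in the class C (Matlis_cotorsion_classC).  Embed C in
    a divisible E, put f : E -> E' = E/C and cover E' by a K-vector space
    q : W -> E'.  Let L be the module of triples (x, w, u), x in E, w a sequence
    in W and u a sequence in E' that is eventually 0, with u_0 = f x and
    u_{i+1} = u_i - q w_i.  Imposing these equations only for i < n, with
    w_i = 0 for i >= n, gives a tower of divisible modules with surjective
    transition maps and limit L.  The map c |-> (c, 0, 0) embeds C in L.  The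
    projection of L to the w has image F inside the K-vector space W^N and
    kernel C, since u is constant and eventually 0 when w = 0.  As
    Ext^1(W^N, C) = 0, the class of 0 -> C -> L -> F -> 0, which extends to W^N,
    vanishes, and C is a direct summand of L.

    If Spec R is countable, K is a union of modules R k_n with
    k_n = a_n k_{n+1}, so that Ext^1(K, L) = 0 amounts to solving
    x_n - a_n x_{n+1} = z_n in L.  When L is the limit of a tower of divisible
    modules I_n, every z_n is congruent modulo a_n L to an element of the
    kernel of L -> I_n, and for such right-hand sides the series
    x_n = sum_k a_n ... a_{n+k-1} z_{n+k} converges (invlim_solve).  Hence the
    members of the class C are cotorsion (classC_cotorsion).

    If Spec R is uncountable, let P be the product of the R/p over the nonzero
    primes p, and N the submodule of elements with countable support.  Each R/p
    is cotorsion, and the class C is closed under products with countable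
    supports because countable sets are closed under countable unions
    (classC_cprod); so N is in the class C.  A nonzero element of R lies
    in finitely many p only, so P/N is a K-vector space, nonzero because P has
    elements of uncountable support, whereas P contains no divisible submodule
    but 0.  So 0 -> N -> P -> P/N -> 0 does not split and N is not cotorsion
    (cotorsion_countable_primes).

    Finally, Spec R is countable if and only if K is countably generated: in
    one direction every nonzero element divides some product of elements picked
    in the nonzero primes (cofinal_divisors), in the other direction every
    nonzero prime contains the denominator of a generator. *)

Lemma dependent_choice T (M : T -> Type) (P : forall i, M i -> Prop) :
  (forall i, exists y, P i y) -> exists f : forall i, M i, forall i, P i (f i).
Proof. by move=> H; exists (fun i => sval (cid (H i))) => i; case: cid. Qed.

(** * Linear maps *)

Section LinearMaps.
Variable R : comNzRingType.
Implicit Types A B D : lmodType R.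

Definition linear_map A B (f : A -> B) (f_lin : linear f) : {linear A -> B} :=
  HB.pack_for {linear A -> B} f (GRing.isLinear.Build R A B *:%R f f_lin).

Lemma linear_mapE A B (f : A -> B) (f_lin : linear f) x :
  linear_map f_lin x = f x.
Proof. by []. Qed.

(** A submodule of A x B that is total over A is single valued as soon as it is
    so over 0.  This disposes of well-definedness for all maps constructed
    below on quotients, direct sums and K. *)
Lemma linear_of_graph A B (G : A -> B -> Prop) :
  (forall a x y u v, G x u -> G y v -> G (a *: x + y) (a *: u + v)) ->
  (forall y, G 0 y -> y = 0) -> (forall x, exists y, G x y) ->
  exists h : {linear A -> B}, forall x, G x (h x).
Proof.
move=> Glin G0 Gtot.
have Guniq x u v : G x u -> G x v -> u = v.
  move=> xu xv; have := Glin (-1) _ _ _ _ xv xu.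
  rewrite !scaleN1r addNr => /G0 /eqP.
  by rewrite addrC subr_eq0 => /eqP.
have [h hG] := choice Gtot.
have h_lin : linear h by move=> a x y; apply: Guniq (hG _) (Glin _ _ _ _ _ _ _).
by exists (linear_map h_lin).
Qed.

Lemma linear_injective A B (f : {linear A -> B}) :
  (forall x, f x = 0 -> x = 0) -> injective f.
Proof.
by move=> f0 x y /eqP; rewrite -subr_eq0 -linearB => /eqP /f0 /subr0_eq.
Qed.

Lemma linear_injective0 A B (f : {linear A -> B}) x :
  injective f -> f x = 0 -> x = 0.
Proof. by move=> fI fx; apply: fI; rewrite linear0. Qed.

Lemma linear_factor_surj A B D (s : {linear A -> B}) (g : {linear A -> D}) :
  (forall b, exists a, s a = b) -> (forall a, s a = 0 -> g a = 0) ->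
  exists h : {linear B -> D}, forall a, h (s a) = g a.
Proof.
move=> ssurj sg.
have [|||h hE] := @linear_of_graph B D (fun b d => exists2 a, s a = b & g a = d).
- by move=> k _ _ _ _ [x <- <-] [y <- <-]; exists (k *: x + y); rewrite linearP.
- by move=> y [a /sg -> <-].
- by move=> b; have [a <-] := ssurj b; exists (g a); exists a.
exists h => a; have [a' /eqP sa <-] := hE (s a).
by move: sa; rewrite -subr_eq0 -linearB => /eqP /sg /eqP; rewrite linearB subr_eq0 => /eqP.
Qed.

Lemma linear_factor_inj A B D (i : {linear B -> D}) (k : {linear A -> D}) :
  injective i -> (forall a, exists b, i b = k a) ->
  exists h : {linear A -> B}, forall a, i (h a) = k a.
Proof.
move=> iI ik.
apply: (@linear_of_graph A B (fun a b => i b = k a)) => //.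
- by move=> c x y u v xu yv; rewrite !linearP xu yv.
- by move=> y; rewrite linear0; exact: linear_injective0.
Qed.

End LinearMaps.

(** * Submodules, quotients and products *)

Section Submodule.
Variables (R : comNzRingType) (M : lmodType R).

Record submodule := Submodule {
  submodule_pred :> M -> Prop;
  submodule0 : submodule_pred 0;
  submoduleP : forall a x y,
    submodule_pred x -> submodule_pred y -> submodule_pred (a *: x + y)
}.

Variable N : submodule.

Lemma submoduleD x y : N x -> N y -> N (x + y).
Proof. by move=> Nx Ny; rewrite -[x]scale1r; exact: submoduleP. Qed.

Lemma submoduleZ a x : N x -> N (a *: x).
Proof. by rewrite -[_ *: _]addr0 => Nx; apply: submoduleP => //; exact: submodule0. Qed.

Lemma submoduleN x : N x -> N (- x).
Proof. by rewrite -scaleN1r; exact: submoduleZ. Qed.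

Lemma submoduleB x y : N x -> N y -> N (x - y).
Proof. by move=> Nx /submoduleN; exact: submoduleD. Qed.

Record sub_module := SubModule { subval : M; subvalP : N subval }.

HB.instance Definition _ := gen_eqMixin sub_module.
HB.instance Definition _ := gen_choiceMixin sub_module.

Lemma subval_inj : injective subval.
Proof.
by case=> [x Nx] [y Ny] /= xy; case: _ / xy Ny => Ny; congr SubModule; exact: Prop_irrelevance.
Qed.

Definition sub_module0 := SubModule (submodule0 N).
Definition sub_module_add x y := SubModule (submoduleD (subvalP x) (subvalP y)).
Definition sub_module_opp x := SubModule (submoduleN (subvalP x)).
Definition sub_module_scale a x := SubModule (submoduleZ a (subvalP x)).

Fact sub_module_addA : associative sub_module_add.
Proof. by move=> x y z; apply: subval_inj; exact: addrA. Qed.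
Fact sub_module_addC : commutative sub_module_add.
Proof. by move=> x y; apply: subval_inj; exact: addrC. Qed.
Fact sub_module_add0 : left_id sub_module0 sub_module_add.
Proof. by move=> x; apply: subval_inj; exact: add0r. Qed.
Fact sub_module_addN : left_inverse sub_module0 sub_module_opp sub_module_add.
Proof. by move=> x; apply: subval_inj; exact: addNr. Qed.

HB.instance Definition _ := GRing.isZmodule.Build sub_module
  sub_module_addA sub_module_addC sub_module_add0 sub_module_addN.

Fact sub_module_scaleA a b x :
  sub_module_scale a (sub_module_scale b x) = sub_module_scale (a * b) x.
Proof. by apply: subval_inj; exact: scalerA. Qed.
Fact sub_module_scale1 : left_id 1 sub_module_scale.
Proof. by move=> x; apply: subval_inj; exact: scale1r. Qed.
Fact sub_module_scaleDr : right_distributive sub_module_scale +%R.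
Proof. by move=> a x y; apply: subval_inj; exact: scalerDr. Qed.
Fact sub_module_scaleDl x a b :
  sub_module_scale (a + b) x = sub_module_scale a x + sub_module_scale b x.
Proof. by apply: subval_inj; exact: scalerDl. Qed.

HB.instance Definition _ := GRing.Zmodule_isLmodule.Build R sub_module
  sub_module_scaleA sub_module_scale1 sub_module_scaleDr sub_module_scaleDl.

Fact subval_linear : linear subval.
Proof. by []. Qed.
HB.instance Definition _ :=
  GRing.isLinear.Build R sub_module M *:%R subval subval_linear.

End Submodule.

Section KernelRange.
Variables (R : comNzRingType) (A B : lmodType R) (f : {linear A -> B}).

Fact kernel0 : f 0 = 0. Proof. exact: linear0. Qed.
Fact kernelP a x y : f x = 0 -> f y = 0 -> f (a *: x + y) = 0.
Proof. by move=> fx fy; rewrite linearP fx fy scaler0 addr0. Qed.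
Definition kernel : submodule A := Submodule kernel0 kernelP.

Fact range0 : exists x, f x = 0. Proof. by exists 0; rewrite linear0. Qed.
Fact rangeP a u v :
  (exists x, f x = u) -> (exists x, f x = v) -> exists x, f x = a *: u + v.
Proof. by move=> [x <-] [y <-]; exists (a *: x + y); rewrite linearP. Qed.
Definition range : submodule B := Submodule range0 rangeP.

End KernelRange.

Section Quotient.
Variables (R : comNzRingType) (M : lmodType R) (N : submodule M).

Definition congr_mod : rel M := fun x y => `[< N (x - y) >].

Fact congr_mod_refl : reflexive congr_mod.
Proof. by move=> x; apply/asboolP; rewrite subrr; exact: submodule0. Qed.
Fact congr_mod_sym : symmetric congr_mod.
Proof. by move=> x y; apply/asboolP/asboolP => /submoduleN; rewrite opprB. Qed.
Fact congr_mod_trans : transitive congr_mod.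
Proof.
move=> y x z /asboolP xy /asboolP yz; apply/asboolP.
by have := submoduleD xy yz; rewrite addrA subrK.
Qed.

Canonical congr_mod_equiv :=
  EquivRel congr_mod congr_mod_refl congr_mod_sym congr_mod_trans.

Definition quot_module := {eq_quot congr_mod_equiv}.
HB.instance Definition _ := Choice.on quot_module.
HB.instance Definition _ := EqQuotient.on quot_module.

Lemma quot_eqP x y : \pi_quot_module x = \pi_quot_module y <-> N (x - y).
Proof. by split=> [/eqmodP /asboolP | xy]; last by apply/eqmodP/asboolP. Qed.

Definition quot_zero : quot_module := \pi_quot_module 0.
Definition quot_add (x y : quot_module) : quot_module :=
  \pi_quot_module (repr x + repr y).
Definition quot_opp (x : quot_module) : quot_module := \pi_quot_module (- repr x).
Definition quot_scale a (x : quot_module) : quot_module :=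
  \pi_quot_module (a *: repr x).

Lemma quot_repr x : N (repr (\pi_quot_module x) - x).
Proof. by apply/quot_eqP; rewrite reprK. Qed.

Lemma quot_addE x y :
  quot_add (\pi_quot_module x) (\pi_quot_module y) = \pi_quot_module (x + y).
Proof.
by apply/quot_eqP; rewrite opprD addrACA; apply: submoduleD; exact: quot_repr.
Qed.

Lemma quot_oppE x : quot_opp (\pi_quot_module x) = \pi_quot_module (- x).
Proof. by apply/quot_eqP; rewrite -opprD; apply: submoduleN; exact: quot_repr. Qed.

Lemma quot_scaleE a x :
  quot_scale a (\pi_quot_module x) = \pi_quot_module (a *: x).
Proof. by apply/quot_eqP; rewrite -scalerBr; apply: submoduleZ; exact: quot_repr. Qed.

Lemma quot_ind (P : quot_module -> Prop) :
  (forall x, P (\pi_quot_module x)) -> forall x, P x.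
Proof. by move=> Ppi x; rewrite -[x]reprK. Qed.

Fact quot_addA : associative quot_add.
Proof.
elim/quot_ind=> x; elim/quot_ind=> y; elim/quot_ind=> z.
by rewrite !quot_addE addrA.
Qed.
Fact quot_addC : commutative quot_add.
Proof. by elim/quot_ind=> x; elim/quot_ind=> y; rewrite !quot_addE addrC. Qed.
Fact quot_add0 : left_id quot_zero quot_add.
Proof. by elim/quot_ind=> x; rewrite quot_addE add0r. Qed.
Fact quot_addN : left_inverse quot_zero quot_opp quot_add.
Proof. by elim/quot_ind=> x; rewrite quot_oppE quot_addE addNr. Qed.

HB.instance Definition _ := GRing.isZmodule.Build quot_module
  quot_addA quot_addC quot_add0 quot_addN.

Fact quot_scaleA a b x : quot_scale a (quot_scale b x) = quot_scale (a * b) x.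
Proof. by elim/quot_ind: x => x; rewrite !quot_scaleE scalerA. Qed.
Fact quot_scale1 : left_id 1 quot_scale.
Proof. by elim/quot_ind=> x; rewrite quot_scaleE scale1r. Qed.
Fact quot_scaleDr : right_distributive quot_scale +%R.
Proof.
move=> a; elim/quot_ind=> x; elim/quot_ind=> y.
by rewrite [_ + _]quot_addE !quot_scaleE [RHS]quot_addE scalerDr.
Qed.
Fact quot_scaleDl x a b : quot_scale (a + b) x = quot_scale a x + quot_scale b x.
Proof. by elim/quot_ind: x => x; rewrite !quot_scaleE [RHS]quot_addE scalerDl. Qed.

HB.instance Definition _ := GRing.Zmodule_isLmodule.Build R quot_module
  quot_scaleA quot_scale1 quot_scaleDr quot_scaleDl.

Definition quot_pi (x : M) : quot_module := \pi_quot_module x.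

Fact quot_pi_linear : linear quot_pi.
Proof.
move=> a x y; rewrite /quot_pi -quot_addE -quot_scaleE.
by [].
Qed.
HB.instance Definition _ :=
  GRing.isLinear.Build R M quot_module *:%R quot_pi quot_pi_linear.

Lemma quot_pi_surj y : exists x, quot_pi x = y.
Proof. by elim/quot_ind: y => x; exists x. Qed.

Lemma quot_pi0 x : quot_pi x = 0 <-> N x.
Proof. by rewrite -[x in N x]subr0; exact: quot_eqP. Qed.

End Quotient.

Section Pi.
Variables (R : comNzRingType) (T : Type) (M : T -> lmodType R).

Definition pi_module : Type := forall i, M i.

HB.instance Definition _ := gen_eqMixin pi_module.
HB.instance Definition _ := gen_choiceMixin pi_module.

Definition pi_zero : pi_module := fun i => 0.
Definition pi_add (x y : pi_module) : pi_module := fun i => x i + y i.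
Definition pi_opp (x : pi_module) : pi_module := fun i => - x i.
Definition pi_scale a (x : pi_module) : pi_module := fun i => a *: x i.

Lemma pi_eqP (x y : pi_module) : (forall i, x i = y i) -> x = y.
Proof. exact: functional_extensionality_dep. Qed.

Fact pi_addA : associative pi_add.
Proof. by move=> x y z; apply: pi_eqP => i; exact: addrA. Qed.
Fact pi_addC : commutative pi_add.
Proof. by move=> x y; apply: pi_eqP => i; exact: addrC. Qed.
Fact pi_add0 : left_id pi_zero pi_add.
Proof. by move=> x; apply: pi_eqP => i; exact: add0r. Qed.
Fact pi_addN : left_inverse pi_zero pi_opp pi_add.
Proof. by move=> x; apply: pi_eqP => i; exact: addNr. Qed.

HB.instance Definition _ := GRing.isZmodule.Build pi_module
  pi_addA pi_addC pi_add0 pi_addN.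

Fact pi_scaleA a b x : pi_scale a (pi_scale b x) = pi_scale (a * b) x.
Proof. by apply: pi_eqP => i; exact: scalerA. Qed.
Fact pi_scale1 : left_id 1 pi_scale.
Proof. by move=> x; apply: pi_eqP => i; exact: scale1r. Qed.
Fact pi_scaleDr : right_distributive pi_scale +%R.
Proof. by move=> a x y; apply: pi_eqP => i; exact: scalerDr. Qed.
Fact pi_scaleDl x a b : pi_scale (a + b) x = pi_scale a x + pi_scale b x.
Proof. by apply: pi_eqP => i; exact: scalerDl. Qed.

HB.instance Definition _ := GRing.Zmodule_isLmodule.Build R pi_module
  pi_scaleA pi_scale1 pi_scaleDr pi_scaleDl.

Lemma pi_addE (x y : pi_module) i : (x + y) i = x i + y i. Proof. by []. Qed.
Lemma pi_scaleE a (x : pi_module) i : (a *: x) i = a *: x i. Proof. by []. Qed.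

Definition pi_proj i (x : pi_module) : M i := x i.
Fact pi_proj_linear i : linear (pi_proj i). Proof. by []. Qed.
HB.instance Definition _ i :=
  GRing.isLinear.Build R pi_module (M i) *:%R (pi_proj i) (@pi_proj_linear i).

End Pi.

(** Supports vary in an ideal of sets, so that direct sums and products with
    countable supports are two instances of one construction. *)
Record support_ideal (T : Type) := SupportIdeal {
  small :> set T -> Prop;
  small0 : small set0;
  smallU : forall A B, small A -> small B -> small (A `|` B);
  smallS : forall A B, A `<=` B -> small B -> small A
}.

Section RestrictedProduct.
Variables (R : comNzRingType) (T : Type) (F : support_ideal T).

Definition supp (M : T -> lmodType R) (x : pi_module M) : set T :=
  [set i | x i <> 0].

Section Module.
Variable M : T -> lmodType R.

Fact small_supp0 : F (supp (0 : pi_module M)).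
Proof. by apply: smallS (small0 F) => i /=. Qed.

Fact small_suppP a (x y : pi_module M) :
  F (supp x) -> F (supp y) -> F (supp (a *: x + y)).
Proof.
move=> Fx Fy; apply: smallS (smallU Fx Fy) => i /= xy; apply: contrapT.
move=> /not_orP[/contrapT x0 /contrapT y0]; apply: xy.
by rewrite pi_addE pi_scaleE x0 y0 scaler0 addr0.
Qed.

Definition rprod := sub_module (Submodule small_supp0 small_suppP).
HB.instance Definition _ := GRing.Lmodule.on rprod.

Definition rprod_fun (x : rprod) : pi_module M := subval x.
Fact rprod_fun_linear : linear rprod_fun. Proof. by []. Qed.
HB.instance Definition _ :=
  GRing.isLinear.Build R rprod (pi_module M) *:%R rprod_fun rprod_fun_linear.

Definition rprod_of (x : pi_module M) (Fx : F (supp x)) : rprod :=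
  @SubModule R _ (Submodule small_supp0 small_suppP) x Fx.

Lemma rprod_ofE x Fx i : rprod_fun (@rprod_of x Fx) i = x i.
Proof. by []. Qed.

Lemma rprodP x : F (supp (rprod_fun x)).
Proof. exact: subvalP x. Qed.

Lemma rprod_eqP (x y : rprod) : (forall i, rprod_fun x i = rprod_fun y i) -> x = y.
Proof. by move=> xy; apply: subval_inj; exact: pi_eqP. Qed.

End Module.

Section Map.
Variables (M N : T -> lmodType R) (f : forall i, {linear M i -> N i}).

Fact rprod_map_supp (x : rprod M) : F (supp (fun i => f i (rprod_fun x i))).
Proof.
apply: smallS (rprodP x) => i /= fx xi; apply: fx.
by rewrite xi linear0.
Qed.

Definition rprod_map (x : rprod M) : rprod N := rprod_of (rprod_map_supp x).

Fact rprod_map_linear : linear rprod_map.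
Proof. by move=> a x y; apply: rprod_eqP => i; exact: linearP. Qed.
HB.instance Definition _ :=
  GRing.isLinear.Build R (rprod M) (rprod N) *:%R rprod_map rprod_map_linear.

End Map.
End RestrictedProduct.

Section SubmoduleZorn.
Variables (R : comNzRingType) (M : lmodType R).
Implicit Types N U : submodule M.

Lemma submodule_eqP N N' : (forall x, N x <-> N' x) -> N = N'.
Proof.
case: N N' => [N N0 NP] [N' N'0 N'P] /= NN'.
have e : N = N' by apply/funext => x; apply/propext.
by case: _ / e N'0 N'P => N'0 N'P; congr Submodule; exact: Prop_irrelevance.
Qed.

Lemma submodule_sum N (I : eqType) (s : seq I) (F : I -> M) :
  (forall i, i \in s -> N (F i)) -> N (\sum_(i <- s) F i).
Proof.
move=> NF; rewrite big_seq; elim/big_ind: _ => //; first exact: submodule0.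
exact: submoduleD.
Qed.

(** Directed form of Zorn's lemma: the second hypothesis holds for every family
    defined by finitary conditions.  It serves both for ideals of a Noetherian
    ring and for graphs of partial linear maps. *)
Lemma submodule_zorn (P : submodule M -> Prop) N0 : P N0 ->
  (forall U, (forall s : seq M, (forall x, x \in s -> U x) ->
     exists N, [/\ P N, forall x, x \in s -> N x & forall x, N x -> U x]) ->
   P U) ->
  exists2 N, P N & forall N', P N' -> (forall x, N x -> N' x) -> N' = N.
Proof.
move=> PN0 Pdir.
pose Q (X : set M) := X = set0 \/ exists2 N, P N & X = [set x | N x].
suff Qchain F : F `<=` Q -> total_on F subset -> Q (\bigcup_(X in F) X).
  have [X [[X0|[N PN XE]] Xmax]] := Zorn_bigcup Qchain.
    exfalso; apply: (Xmax [set x | N0 x]); last by right; exists N0.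
    rewrite X0; split=> [x []|/(_ 0)]; apply; exact: submodule0 N0.
  exists N => // N' PN' NN'; apply: submodule_eqP => x; split; last exact: NN'.
  move=> N'x; apply: contrapT => Nx.
  apply: (Xmax [set x | N' x]); last by right; exists N'.
  by rewrite XE; split => // /(_ x N'x).
move=> FQ Ftot.
have [[X [FX [x0 Xx0]]]|F0] := pselect (exists X, F X /\ X !=set0); last first.
  left; apply/seteqP; split => // x [X FX Xx]; apply: F0; exists X.
  by split => //; exists x.
right; pose U := \bigcup_(X in F) X.
have U0 : U 0.
  exists X => //; case: (FQ _ FX) => [X0|[N _ ->]]; last exact: submodule0 N.
  by move: Xx0; rewrite X0.
have UP a x y : U x -> U y -> U (a *: x + y).
  move=> [Y FY Yx] [Z FZ Zy].
  have [W FW [Wx Wy]] : exists2 W, F W & W x /\ W y.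
    by have [/(_ _ Yx)|/(_ _ Zy)] := Ftot _ _ FY FZ; [exists Z | exists Y].
  by exists W => //; case: (FQ _ FW) Wx Wy => [->//|[N _ ->]]; exact: submoduleP.
exists (Submodule U0 UP) => //; apply: Pdir => s sU /=.
have [Y FY [Y0 Ys]] : exists2 Y, F Y & Y !=set0 /\ forall x, x \in s -> Y x.
  elim: s sU => [|x s IH] sU; first by exists X => //; split => //; exists x0.
  have [|Y FY [Y0 Ys]] := IH; first by move=> y ys; apply: sU; rewrite inE ys orbT.
  have [Z FZ Zx] : U x by apply: sU; rewrite mem_head.
  have [YZ|ZY] := Ftot _ _ FY FZ.
    exists Z => //; split=> [|y]; first by exists x.
    by rewrite inE => /predU1P[->//|/Ys /YZ].
  exists Y => //; split=> // y.
  by rewrite inE => /predU1P[->|/Ys//]; exact: ZY.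
case: (FQ _ FY) => [YE|[N PN YE]]; first by case: Y0; rewrite YE.
exists N; split=> // [x /Ys|x Nx]; first by rewrite YE.
by exists Y; rewrite // YE.
Qed.

End SubmoduleZorn.
(** * Ideals of a Dedekind domain *)

Section FractionField.
Variable R : idomainType.

Lemma frac_exists (z : {fraction R}) :
  exists2 ab : R * R, ab.2 != 0 & z = FracField.tofrac ab.1 / FracField.tofrac ab.2.
Proof.
elim/quotW: z => -[[a b] /= b0]; exists (a, b) => //=.
have b0F : FracField.tofrac b != 0 by rewrite tofrac_eq0.
apply: (mulIf b0F); rewrite mulfVK //.
rewrite !piE; apply/eqmodP; rewrite /= FracField.equivfE /FracField.mulf.
by rewrite !numden_Ratio ?mulf_neq0 ?oner_neq0 //= !mulr1 mulrC.
Qed.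

End FractionField.

Notation ideal R := (submodule (R^o : lmodType R)).

Section Ideals.
Variable R : idomainType.
Implicit Types (J : ideal R) (a b x y : R).

Lemma idealM J a x : J x -> J (a * x).
Proof. exact: (@submoduleZ R R^o J). Qed.

Lemma idealD J x y : J x -> J y -> J (x + y).
Proof. exact: (@submoduleD R R^o J). Qed.

Lemma ideal_sum J (I : Type) (s : seq I) (P : pred I) (F : I -> R) :
  (forall i, P i -> J (F i)) -> J (\sum_(i <- s | P i) F i).
Proof.
move=> JF; elim/big_ind: _ => //; [exact: submodule0 J | exact: idealD].
Qed.

Section AddPrincipal.
Variables (J : ideal R) (y : R).
Definition add_principal_pred x := exists2 k : R * R, J k.1 & x = k.1 + k.2 * y.
Fact add_principal0 : add_principal_pred 0.
Proof. by exists (0, 0); rewrite /= ?mul0r ?addr0 //; exact: submodule0. Qed.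
Fact add_principalP a u v : add_principal_pred u -> add_principal_pred v ->
  add_principal_pred (a * u + v).
Proof.
move=> [[j r] /= Jj ->] [[k t] /= Jk ->]; exists (a * j + k, a * r + t) => /=.
  by apply: idealD Jk; exact: idealM.
by rewrite mulrDr mulrDl mulrA addrACA.
Qed.
Definition add_principal : ideal R :=
  @Submodule R R^o add_principal_pred add_principal0 add_principalP.

Lemma add_principalS x : J x -> add_principal x.
Proof. by exists (x, 0); rewrite /= ?mul0r ?addr0. Qed.
Lemma add_principal_gen : add_principal y.
Proof. by exists (0, 1); rewrite /= ?mul1r ?add0r //; exact: submodule0 J. Qed.
End AddPrincipal.

Section Colon.
Variables (a b : R).
Fact colon0 : exists c, 0 * b = c * a. Proof. by exists 0; rewrite !mul0r. Qed.
Fact colonP k u v : (exists c, u * b = c * a) -> (exists c, v * b = c * a) ->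
  exists c, (k * u + v) * b = c * a.
Proof. by move=> [c uc] [d vd]; exists (k * c + d); rewrite !mulrDl -mulrA uc vd mulrA. Qed.
Definition colon : ideal R :=
  @Submodule R R^o (fun x => exists c, x * b = c * a) colon0 colonP.
End Colon.

Definition prime_ideal J := ~ J 1 /\ forall x y, J (x * y) -> J x \/ J y.
Definition nonzero_ideal J := exists2 x, J x & x != 0.

Lemma prime_ideal_prod J (I : eqType) (s : seq I) (f : I -> R) :
  prime_ideal J -> J (\prod_(i <- s) f i) -> exists2 i, i \in s & J (f i).
Proof.
move=> [J1 Jp]; elim: s => [|i s IH]; first by rewrite big_nil.
rewrite big_cons => /Jp[Ji | /IH[j js Jj]].
  by exists i => //; rewrite mem_head.
by exists j => //; rewrite inE js orbT.
Qed.

Definition ideal_pred J : {pred R} := fun x => `[< J x >].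

Lemma ideal_pred_closed J : ~ J 1 -> idealr_closed (ideal_pred J).
Proof.
move=> J1; split.
- by apply/asboolP; exact: submodule0.
- by apply/asboolP.
- move=> a x y /asboolP Jx /asboolP Jy; apply/asboolP.
  by apply: idealD Jy; exact: idealM.
Qed.

Lemma ideal_predE J x : (x \in ideal_pred J) = `[< J x >]. Proof. by []. Qed.

Section OfPred.
Variables (p : {pred R}) (pP : idealr_closed p).
Fact ideal_of_pred0 : 0 \in p. Proof. by case: pP. Qed.
Fact ideal_of_predP a x y : x \in p -> y \in p -> a * x + y \in p.
Proof. by case: pP => _ _; apply. Qed.
Definition ideal_of_pred : ideal R :=
  @Submodule R R^o (fun x => x \in p) ideal_of_pred0 ideal_of_predP.
End OfPred.

Section Dedekind.
Hypothesis hR : dedekind R.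

Lemma ideal_fg J : exists2 s : seq R, (forall x, x \in s -> J x) &
  forall x, J x -> exists c : 'I_(size s) -> R, x = \sum_(i < size s) c i * s`_i.
Proof.
have [J1|J1] := pselect (J 1).
  exists [:: 1] => [x|x _]; first by rewrite inE => /eqP ->.
  by exists (fun=> x); rewrite big_ord1 mulr1.
case: hR => noeth _ _; have [s sP] := noeth _ (ideal_pred_closed J1).
exists s => [x xs | x Jx]; last by apply/sP; apply/asboolP.
apply/asboolP/sP; exists (fun i : 'I_(size s) => (i == index x s :> nat)%:R).
have lt_i : (index x s < size s)%N by rewrite index_mem.
rewrite (bigD1 (Ordinal lt_i)) //= eqxx mul1r nth_index // big1 ?addr0 // => i.
by rewrite -val_eqE /= => /negbTE ->; rewrite mul0r.
Qed.

(** Finite generation of U makes it equal to the member of the family that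
    contains its generators. *)
Lemma ideal_maximal (P : ideal R -> Prop) J0 : P J0 ->
  exists2 J, P J & forall J', P J' -> (forall x, J x -> J' x) -> forall x, J' x -> J x.
Proof.
move=> PJ0; suff [J PJ Jmax] : exists2 J, P J & forall J', P J' ->
    (forall x, J x -> J' x) -> J' = J.
  by exists J => // J' PJ' JJ'; rewrite (Jmax J').
apply: (submodule_zorn PJ0) => U Udir.
have [s sU Us] := ideal_fg U.
have [N [PN sN NU]] := Udir s sU.
suff -> : U = N by [].
apply: submodule_eqP => x; split; last exact: NU.
move=> /Us[c ->]; apply: ideal_sum => i _; apply: idealM.
by apply: sN; exact: mem_nth.
Qed.

Lemma prime_maximal J J' : prime_ideal J -> nonzero_ideal J ->
  (forall x, J x -> J' x) -> ~ J' 1 -> forall x, J' x -> J x.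
Proof.
move=> [J1 Jp] [x Jx x0] JJ' J'1.
case: hR => _ _ /(_ (ideal_pred J)) [].
- split; first exact: ideal_pred_closed.
  by move=> u v /asboolP /Jp[?|?]; apply/orP; [left|right]; apply/asboolP.
- by exists x => //; apply/asboolP.
move=> _ /(_ _ (ideal_pred_closed J'1)) H y J'y.
apply/asboolP; rewrite -ideal_predE -H; first exact/asboolP.
by move=> z /asboolP /JJ' J'z; apply/asboolP.
Qed.

Lemma maximal_ideal_prime J : ~ J 1 ->
  (forall J', ~ J' 1 -> (forall x, J x -> J' x) -> forall x, J' x -> J x) ->
  prime_ideal J.
Proof.
move=> J1 Jmax; split=> // x y Jxy.
have [|Jx] := pselect (J x); [by left | right].
have [[[j r] /= Jj jr]|H] := pselect (add_principal J x 1); last first.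
  case: Jx; apply: Jmax H _ _ (add_principal_gen J x) => z.
  exact: add_principalS.
rewrite -[y]mul1r jr mulrDl; apply: idealD; first by rewrite mulrC; exact: idealM.
by rewrite -mulrA; apply: idealM.
Qed.

(** The inverse of a proper ideal J is larger than R, as it contains b / a.
    Choose a maximal ideal p containing J and a nonzero a in p.  The
    ideals (a : b) inside p are the annihilators of the b that do not vanish in
    the localization of R/aR at p; a maximal one is prime, as any associated
    prime, and nonzero, hence equal to p since nonzero primes are maximal. *)
Lemma inverse_nontrivial J : ~ J 1 -> nonzero_ideal J ->
  exists a b, [/\ a != 0, forall x, J x -> exists c, x * b = c * a &
                  forall c, b <> c * a].
Proof.
move=> J1 [a Ja a0].
have [p [p1 Jp] pmax] := @ideal_maximal
  (fun p => ~ p 1 /\ forall x, J x -> p x) J (conj J1 (fun x Jx => Jx)).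
have pprime : prime_ideal p.
  apply: maximal_ideal_prime => // J' J'1 pJ'; apply: pmax => //; split => // x /Jp.
  exact: pJ'.
have pa : p a by exact: Jp.
have [|q [b [qE qp]] qmax] := @ideal_maximal
  (fun q => exists b, q = colon a b /\ forall x, q x -> p x) (colon a 1).
  by exists 1; split=> // x [c]; rewrite mulr1 => ->; exact: idealM.
have q1 : ~ q 1 by move=> /qp.
have qprime : prime_ideal q.
  split=> // x y qxy; apply: contrapT => /not_orP[qx qy].
  have [s ps qsx] : exists2 s, ~ p s & q (s * x).
    apply: contrapT => H; apply: qy.
    apply: (qmax (colon a (b * x))).
    - exists (b * x); split=> // s [c sc].
      apply: contrapT => ps; apply: H; exists s => //.
      by rewrite qE; exists c; rewrite -sc mulrAC mulrA.
    - by move=> z; rewrite qE => -[c zc]; exists (c * x); rewrite mulrA zc mulrAC.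
    - by move: qxy; rewrite qE => -[c e]; exists c; rewrite -e mulrA mulrC mulrA.
  have [t pt qts] : exists2 t, ~ p t & q (t * s).
    apply: contrapT => H; apply: qx.
    apply: (qmax (colon a (b * s))).
    - exists (b * s); split=> // t [c tc].
      apply: contrapT => pt; apply: H; exists t => //.
      by rewrite qE; exists c; rewrite -tc mulrAC mulrA.
    - by move=> z; rewrite qE => -[c zc]; exists (c * s); rewrite mulrA zc mulrAC.
    - by move: qsx; rewrite qE => -[c e]; exists c; rewrite -e mulrA mulrC mulrA.
  by case: (pprime.2 _ _ (qp _ qts)).
have qa : q a by rewrite qE; exists b; rewrite mulrC.
exists a, b; split=> // [x Jx | c bc]; last by apply: q1; rewrite qE; exists c; rewrite mul1r.
have : q x by apply: (prime_maximal qprime _ qp) => //; [exists a | exact: Jp].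
by rewrite qE.
Qed.

(** If b / a maps J into itself, its action on a finite family of generators of
    J is a matrix over R having b / a as eigenvalue, the generators being the
    eigenvector.  So b / a is a root of a monic polynomial over R. *)
Lemma integral_multiplier J a b : nonzero_ideal J -> a != 0 ->
  (forall x, J x -> exists2 y, J y & x * b = y * a) -> exists c, b = c * a.
Proof.
move=> [x0 Jx0 x00] a0 JJ.
have [s sJ Js] := ideal_fg J.
have [M MP] : exists M : 'M[R]_(size s),
    forall i : 'I_(size s), s`_i * b = (\sum_(j < size s) s`_j * M j i) * a.
  have H (i : 'I_(size s)) : exists c : 'I_(size s) -> R,
      s`_i * b = (\sum_(j < size s) c j * s`_j) * a.
    have [y /Js[c ->] e] := JJ _ (sJ _ (mem_nth 0 (ltn_ord i))).
    by exists c.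
  have [c cP] := choice H.
  exists (\matrix_(j, i) c i j) => i; rewrite cP; congr (_ * _).
  by apply: eq_bigr => j _; rewrite mxE mulrC.
have aF : FracField.tofrac a != 0 by rewrite tofrac_eq0.
pose z := FracField.tofrac b / FracField.tofrac a.
have [] := (let: And3 _ ic _ := hR in ic) z.
  exists (char_poly M); first exact: char_poly_monic.
  rewrite map_char_poly -eigenvalue_root_char; apply/eigenvalueP.
  exists (\row_j FracField.tofrac s`_j).
    apply/rowP => i; rewrite !mxE; apply: (mulIf aF).
    rewrite [RHS]mulrAC /z mulfVK // [RHS]mulrC -[RHS]tofracM MP tofracM; congr (_ * _).
    by rewrite rmorph_sum; apply: eq_bigr => j _; rewrite !mxE; exact/esym/tofracM.
  apply/negP => /eqP/rowP s0.
  have [c xE] := Js _ Jx0; case/eqP: x00; rewrite xE big1 // => i _.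
  by have := s0 i; rewrite !mxE => /eqP; rewrite tofrac_eq0 => /eqP ->; rewrite mulr0.
move=> c /(congr1 (fun u => u * FracField.tofrac a)).
rewrite mulfVK // -tofracM => /eqP; rewrite tofrac_eq => /eqP ->.
by exists c.
Qed.

(** The fractions c / d belong to the inverse of J and the sum of the a (c / d)
    is 1; a common denominator d keeps the statement inside R. *)
Definition invertible_ideal J := exists d (s : seq (R * R)), d != 0 /\
  [/\ forall ac, ac \in s -> J ac.1,
      forall ac r, ac \in s -> J r -> exists e, r * ac.2 = e * d &
      \sum_(ac <- s) ac.2 * ac.1 = d].

(** Let J be maximal among the nonzero ideals that are not invertible, and let
    b / a be in its inverse but not in R.  The ideal J' = J + (b / a) J is
    different from J by integral closedness, so it is invertible; but J divides
    J', hence J is invertible too. *)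
Lemma nonzero_ideal_invertible J : nonzero_ideal J -> invertible_ideal J.
Proof.
move=> J0; apply: contrapT => Jinv.
have {J J0 Jinv} [J [J0 Jinv] Jmax] := ideal_maximal
  (P := fun J => nonzero_ideal J /\ ~ invertible_ideal J) (conj J0 Jinv).
have [J1|/inverse_nontrivial /(_ J0)[a [b [a0 Jb ba]]]] := pselect (J 1).
  apply: Jinv; exists 1, [:: (1, 1)]; split; first exact: oner_neq0.
  split=> [ac|ac r|]; rewrite ?inE ?big_seq1 ?mulr1 //.
  - by move=> /eqP ->.
  - by move=> _ _; exists (r * ac.2); rewrite mulr1.
(* J' = J + (b / a) J, with denominators cleared *)
pose J'pred x := exists2 yz : R * R, J yz.1 /\ J yz.2 & a * x = a * yz.1 + b * yz.2.
have J'0 : J'pred 0.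
  by exists (0, 0); rewrite /= ?mulr0 ?addr0 //; split; exact: submodule0.
have J'P k x y : J'pred x -> J'pred y -> J'pred (k * x + y).
  move=> [[u v] /= [Ju Jv] xE] [[u' v'] /= [Ju' Jv'] yE].
  exists (k * u + u', k * v + v') => /=.
    by split; apply: idealD => //; exact: idealM.
  by rewrite mulrDr mulrCA xE yE !mulrDr addrACA !(mulrCA k).
pose J' : ideal R := @Submodule R R^o J'pred J'0 J'P.
have JJ' x : J x -> J' x.
  by exists (x, 0); rewrite /= ?mulr0 ?addr0 //; split=> //; exact: submodule0.
have J'nz : nonzero_ideal J' by case: J0 => x Jx x0; exists x => //; exact: JJ'.
have [J'inv|J'inv] := pselect (invertible_ideal J'); last first.
  have [|c bE] := integral_multiplier (b := b) J0 a0; last exact: ba bE.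
  move=> x Jx; have [c xb] := Jb _ Jx; exists c => //.
  apply: (Jmax J' (conj J'nz J'inv) JJ').
  exists (0, x); rewrite /=; first by split=> //; exact: submodule0.
  by rewrite mulr0 add0r mulrC -xb mulrC.
case: J'inv => d [s [d0 [sJ' sd sE]]]; apply: Jinv.
have H (ac : R * R) : exists yz : R * R, ac \in s ->
    [/\ J yz.1, J yz.2 & a * ac.1 = a * yz.1 + b * yz.2].
  have [/sJ'[yz [Jy Jz] e]|] := boolP (ac \in s); first by exists yz.
  by exists (0, 0).
have [f fP] := choice H.
(* b / a times the second component moves to the coefficients *)
exists (a * d), (flatten [seq [:: ((f ac).1, a * ac.2); ((f ac).2, b * ac.2)] | ac <- s]).
split; first exact: mulf_neq0.
split.
- move=> x /flatten_mapP[ac /fP acP]; have [Jy Jz _] := acP.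
  by rewrite !inE => /orP[] /eqP ->.
- move=> x r /flatten_mapP[ac acs] + Jr; rewrite !inE => /orP[] /eqP -> /=.
    have [e re] := sd _ _ acs (JJ' _ Jr).
    by exists e; rewrite mulrCA re mulrCA.
  have [c rb] := Jb _ Jr.
  have [|e re] := sd ac c acs.
    exists (0, r); rewrite /= ?mulr0 ?add0r; first by split=> //; exact: submodule0.
    by rewrite mulrC -rb mulrC.
  by exists e; rewrite mulrA rb mulrAC re -mulrA (mulrC d).
- rewrite big_flatten big_map -sE mulr_sumr big_seq [RHS]big_seq.
  apply: eq_bigr => ac /fP[_ _ e].
  rewrite big_cons big_seq1 /= [RHS]mulrCA e mulrDr.
  by rewrite !(mulrCA ac.2) !mulrA.
Qed.

End Dedekind.
End Ideals.
(** * Divisible modules *)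

Section Divisible.
Variable R : idomainType.
Implicit Types A B D M V : lmodType R.

Definition divisible M := forall (a : R) (x : M), a != 0 -> exists y, a *: y = x.
Definition torsion_free M := forall (a : R) (x : M), a != 0 -> a *: x = 0 -> x = 0.

Lemma injective_divisible M : injective_module M -> divisible M.
Proof.
move=> Minj a x a0.
have mul_lin : linear (fun r : R^o => r * a : R^o).
  by move=> k u v; rewrite /= mulrDl -mulrA.
have x_lin : linear (fun r : R^o => r *: x).
  by move=> k u v; rewrite scalerDl scalerA.
have [|g gE] := Minj R^o R^o (linear_map mul_lin) (linear_map x_lin).
  by move=> u v; exact: (mulIf a0).
exists (g 1); rewrite -linearZ.
by have := gE 1; rewrite /= mul1r scale1r => <-; rewrite /GRing.scale /= mulr1.
Qed.

Lemma torsion_free_scale_inj M (a : R) : torsion_free M -> a != 0 -> injective ( *:%R a : M -> M).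
Proof.
move=> tf a0 x y /eqP; rewrite -subr_eq0 -scalerBr => /eqP /(tf _ _ a0).
exact: subr0_eq.
Qed.

Lemma frac_scaleE (a : R) (x : frac_module R) :
  a *: x = (FracField.tofrac a * x : {fraction R}).
Proof. by []. Qed.

Lemma frac_module_divisible : divisible (frac_module R).
Proof.
move=> a x a0; exists ((FracField.tofrac a)^-1 * x : {fraction R}).
by rewrite frac_scaleE mulVKf // tofrac_eq0.
Qed.

Lemma frac_module_torsion_free : torsion_free (frac_module R).
Proof.
move=> a x a0 /eqP; rewrite frac_scaleE mulf_eq0 tofrac_eq0 (negbTE a0).
by move=> /eqP.
Qed.

Lemma divisible_quot M (N : submodule M) :
  divisible M -> divisible (quot_module N).
Proof.
move=> Mdiv a y a0; have [x <-] := quot_pi_surj y.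
by have [z <-] := Mdiv a x a0; exists (quot_pi N z); rewrite -linearZ.
Qed.

Lemma divisible_rprod T (F : support_ideal T) (M : T -> lmodType R) :
  (forall i, divisible (M i)) -> divisible (rprod F M).
Proof.
move=> Mdiv a x a0.
have H i : exists y, a *: y = rprod_fun x i /\ (rprod_fun x i = 0 -> y = 0).
  have [->|xi] := pselect (rprod_fun x i = 0); first by exists 0; rewrite scaler0.
  by have [y ay] := Mdiv i a (rprod_fun x i) a0; exists y.
have [y yP] := dependent_choice H.
have Fy : F (supp (y : pi_module M)).
  by apply: smallS (rprodP x) => i /= yi xi; apply: yi; exact: (yP i).2.
by exists (rprod_of Fy); apply: rprod_eqP => i; exact: (yP i).1.
Qed.

Lemma divisible_pi T (M : T -> lmodType R) :
  (forall i, divisible (M i)) -> divisible (pi_module M).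
Proof.
move=> Mdiv a x a0; have [y yP] := dependent_choice (fun i => Mdiv i a (x i) a0).
by exists y; exact: pi_eqP.
Qed.

Lemma torsion_free_pi T (M : T -> lmodType R) :
  (forall i, torsion_free (M i)) -> torsion_free (pi_module M).
Proof.
by move=> tf a x a0 ax; apply: pi_eqP => i; apply: tf a0 _; rewrite -pi_scaleE ax.
Qed.

Lemma torsion_free_sub M (N : submodule M) :
  torsion_free M -> torsion_free (sub_module N).
Proof.
move=> tf a x a0 ax; apply: subval_inj; apply: tf a0 _.
by rewrite -linearZ ax.
Qed.

Hypothesis hR : dedekind R.

Section Extension.
Variables A B D : lmodType R.
Variables (f : {linear A -> B}) (g : {linear A -> D}).
Hypotheses (Ddiv : divisible D) (fg : forall a, f a = 0 -> g a = 0).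

Let partial (G : submodule (B * D)%type) :=
  (forall a, G (f a, g a)) /\ forall y, G (0, y) -> y = 0.

Let partial_graph : exists G, partial G.
Proof.
have G0 : exists a, (f a, g a) = 0 by exists 0; rewrite !linear0.
have GP k (x y : B * D) : (exists a, (f a, g a) = x) -> (exists a, (f a, g a) = y) ->
    exists a, (f a, g a) = k *: x + y.
  by move=> [a <-] [b <-]; exists (k *: a + b); rewrite !linearP.
exists (Submodule G0 GP); split=> [a|y]; first by exists a.
by move=> [a [/fg + ay]]; rewrite ay.
Qed.

(** The ideal of all r such that r b is in the domain of G is 0 or invertible.
    In the latter case divide by d the values of G at the a b and combine the
    quotients with the coefficients c. *)
Let partial_value G (b : B) : partial G ->
  exists y0, forall r y, G (r *: b, y) -> y = r *: y0.
Proof.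
move=> [_ G0].
have Guniq x u v : G (x, u) -> G (x, v) -> u = v.
  move=> xu xv; apply/subr0_eq/G0.
  by have : G (x - x, u - v) := submoduleB xu xv; rewrite subrr.
pose J r := exists y, G (r *: b, y).
have J0 : J 0 by exists 0; rewrite scale0r; exact: submodule0 G.
have JP k r t : J r -> J t -> J (k * r + t).
  move=> [u ru] [v tv]; exists (k *: u + v).
  rewrite scalerDl -scalerA; exact: (submoduleP k ru tv).
have [Jnz|Jz] := pselect (exists2 x, J x & x != 0); last first.
  exists 0 => r y ry; rewrite scaler0.
  have [r0|r0] := eqVneq r 0; first by apply: G0; rewrite -(scale0r b) -r0.
  by case: Jz; exists r => //; exists y.
have [d [s [d0 [sJ sd sE]]]] :=
  nonzero_ideal_invertible hR (J := @Submodule R R^o J J0 JP) Jnz.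
have H (ac : R * R) : exists z, ac \in s -> G (ac.1 *: b, d *: z).
  have [/sJ[y ay]|] := boolP (ac \in s); last by exists 0.
  by have [z zE] := Ddiv y d0; exists z; rewrite zE.
have [z zP] := choice H.
exists (\sum_(ac <- s) ac.2 *: z ac) => r y ry.
have He (ac : R * R) : exists e, ac \in s -> r * ac.2 = e * d.
  have [acs|] := boolP (ac \in s); last by exists 0.
  by have [e eP] := sd ac r acs (ex_intro _ y ry); exists e.
have [e eP] := choice He.
apply: Guniq ry _.
have rE : r = \sum_(ac <- s) e ac * ac.1.
  apply: (mulIf d0); rewrite -{1}sE mulr_sumr mulr_suml big_seq [RHS]big_seq.
  by apply: eq_bigr => ac acs; rewrite mulrA eP // mulrAC.
have -> : (r *: b, r *: (\sum_(ac <- s) ac.2 *: z ac)) =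
          \sum_(ac <- s) (e ac *: (ac.1 *: b, d *: z ac)) :> B * D.
  rewrite {1}rE scaler_suml scaler_sumr.
  rewrite [LHS](_ : _ = (\sum_(ac <- s) e ac *: (ac.1 *: b), \sum_(ac <- s) e ac *: (d *: z ac))).
    by elim: (s) => [|ac s' IH]; rewrite ?big_nil // !big_cons -IH.
  congr pair; first by apply: eq_bigr => ac _; rewrite scalerA.
  rewrite big_seq [RHS]big_seq; apply: eq_bigr => ac acs.
  by rewrite !scalerA eP.
by apply: submodule_sum => ac acs; apply: submoduleZ; exact: zP.
Qed.

(** Divisible modules are injective, in a form that allows f to have a kernel
    and thereby avoids the image of f.  The proof is Baer's: a maximal partial
    extension, viewed as a submodule of B x D, is total. *)
Lemma divisible_extends : exists h : {linear B -> D}, forall a, h (f a) = g a.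
Proof.
have [G0 PG0] := partial_graph.
have [|G PG Gmax] := submodule_zorn PG0.
  move=> U Udir; split=> [a|y Uy].
    have [|N [[Nfg _] _ NU]] := Udir [::]; first by [].
    exact: NU.
  have [|N [[_ N0] Ns _]] := Udir [:: (0, y)].
    by move=> x; rewrite inE => /eqP ->.
  by apply: N0; apply: Ns; rewrite mem_head.
have [Gfg Gfun] := PG.
have Gtot b : exists y, G (b, y).
  have [y0 y0P] := partial_value b PG.
  (* the graph of the extension of G to b, with value y0 *)
  pose H (x : B * D) := exists2 u, G u & exists r, x = u + (r *: b, r *: y0).
  have H0 : H 0.
    exists 0; first exact: submodule0.
    by exists 0; rewrite !scale0r addr0.
  have HP k x y : H x -> H y -> H (k *: x + y).
    move=> [u Gu [r ->]] [v Gv [t ->]]; exists (k *: u + v); first exact: submoduleP.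
    exists (k * r + t); rewrite scalerDr addrACA; congr (_ + _).
    by rewrite !scalerDl -!scalerA.
  have := Gmax (Submodule H0 HP) => <-.
  - exists y0; exists 0; first exact: submodule0.
    by exists 1; rewrite !scale1r add0r.
  - split=> [a|y [[u v] Guv [r [uE ->]]]].
      by exists (f a, g a) => //; exists 0; rewrite !scale0r addr0.
    have uE' : u = (- r) *: b by apply/eqP; rewrite scaleNr -addr_eq0 -uE.
    rewrite uE' in Guv; rewrite (y0P _ _ Guv).
    by rewrite scaleNr addNr.
  - by move=> x Gx; exists x => //; exists 0; rewrite !scale0r addr0.
have [|||h hP] := @linear_of_graph R B D (fun b y => G (b, y)) => //.
  by move=> k x y u v xu yv; exact: (submoduleP k xu yv).
exists h => a; apply/subr0_eq/Gfun.
by have : G (f a - f a, h (f a) - g a) := submoduleB (hP (f a)) (Gfg a); rewrite subrr.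
Qed.

End Extension.

Lemma divisible_injective M : divisible M -> injective_module M.
Proof.
move=> Mdiv A B i f iI; apply: divisible_extends => // a ia.
by rewrite (linear_injective0 iI ia) linear0.
Qed.

End Divisible.
(** * Direct sums and free modules *)

Section FiniteSupports.
Variable T : Type.
Fact finite_small0 : finite_set (set0 : set T). Proof. exact: finite_set0. Qed.
Fact finite_smallU (A B : set T) :
  finite_set A -> finite_set B -> finite_set (A `|` B).
Proof. by move=> Afin Bfin; rewrite finite_setU. Qed.
Definition finite_supports : support_ideal T :=
  SupportIdeal finite_small0 finite_smallU (@sub_finite_set T).
End FiniteSupports.

Section DirectSum.
Variables (R : comNzRingType) (X : choiceType) (A : lmodType R).

Definition dsum := rprod (finite_supports X) (fun _ : X => A).
HB.instance Definition _ := GRing.Lmodule.on dsum.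

Definition delta_fun (x : X) (a : A) : pi_module (fun _ : X => A) :=
  fun i => if i == x then a else 0.

Fact delta_supp x a : finite_supports X (supp (delta_fun x a)).
Proof.
apply: sub_finite_set (finite_set1 x) => i; rewrite /supp /delta_fun /=.
by have [->|_ /(_ erefl)] := eqVneq i x.
Qed.

Definition delta x a : dsum := rprod_of (delta_supp x a).

Fact delta_linear x : linear (delta x).
Proof.
move=> k a b; apply: rprod_eqP => i; rewrite /= /delta_fun.
by rewrite pi_addE pi_scaleE /delta_fun; case: (i == x); rewrite ?scaler0 ?addr0.
Qed.
HB.instance Definition _ x :=
  GRing.isLinear.Build R A dsum *:%R (delta x) (delta_linear x).

(** Sums over a direct sum are computed along any such list, by supp_seq_sum. *)
Definition supp_seq (y : dsum) (s : seq X) :=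
  uniq s /\ forall x, rprod_fun y x <> 0 -> x \in s.

Lemma supp_seq_exists y : exists s, supp_seq y s.
Proof.
exists (fset_set (supp (rprod_fun y))); split; first exact: fset_uniq.
by move=> x yx; rewrite in_fset_set ?inE //; exact: (rprodP y).
Qed.

Lemma supp_seq_cat y s t : supp_seq y s -> supp_seq y (undup (s ++ t)).
Proof.
move=> [_ sP]; split=> [|x /sP xs]; first exact: undup_uniq.
by rewrite mem_undup mem_cat xs.
Qed.

Lemma supp_seq_sum (D : lmodType R) (h : X -> {linear A -> D}) y s t :
  supp_seq y s -> supp_seq y t ->
  \sum_(x <- s) h x (rprod_fun y x) = \sum_(x <- t) h x (rprod_fun y x).
Proof.
pose P x := rprod_fun y x != 0.
have sumP r : \sum_(x <- r) h x (rprod_fun y x) =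
    \sum_(x <- [seq x <- r | P x]) h x (rprod_fun y x).
  rewrite big_filter [RHS]big_mkcond; apply: eq_bigr => x _; rewrite /P.
  by case: eqP => //= ->; rewrite linear0.
move=> [s_uniq sP] [t_uniq tP]; rewrite sumP [RHS]sumP; apply: perm_big.
apply: uniq_perm; rewrite ?filter_uniq // => x; rewrite !mem_filter.
by have [/eqP yx|//] := boolP (P x); rewrite sP ?tP.
Qed.

Lemma dsum_decomp (y : dsum) s : supp_seq y s ->
  y = \sum_(x <- s) delta x (rprod_fun y x).
Proof.
move=> [s_uniq sP]; apply: rprod_eqP => i.
pose ev : {linear dsum -> A} := pi_proj (M := fun _ : X => A) i \o
  rprod_fun (F := finite_supports X) (M := fun _ : X => A).
have evE (z : dsum) : rprod_fun z i = ev z by [].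
rewrite [RHS]evE linear_sum.
have deltaE x : ev (delta x (rprod_fun y x)) = if i == x then rprod_fun y x else 0 by [].
clearbody ev; have [si|si] := boolP (i \in s).
  rewrite (bigD1_seq i) //= deltaE eqxx big1 ?addr0 // => x.
  by rewrite eq_sym => /negbTE ix; rewrite deltaE ix.
rewrite big_seq big1 => [|x xs].
  by apply: contrapT => /sP; rewrite (negbTE si).
by rewrite deltaE; case: eqP => // ix; rewrite ix xs in si.
Qed.

Lemma dsum_ext (D : lmodType R) (f g : {linear dsum -> D}) :
  (forall x a, f (delta x a) = g (delta x a)) -> forall y, f y = g y.
Proof.
move=> fg y; have [s sP] := supp_seq_exists y.
by rewrite (dsum_decomp sP) !linear_sum; apply: eq_bigr => x _.
Qed.

Lemma dsum_lift (D : lmodType R) (h : X -> {linear A -> D}) :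
  exists H : {linear dsum -> D}, forall x a, H (delta x a) = h x a.
Proof.
pose G (y : dsum) d := exists2 s, supp_seq y s & d = \sum_(x <- s) h x (rprod_fun y x).
have [|||H HG] := @linear_of_graph R dsum D G.
- move=> k y z _ _ [s ys ->] [t zt ->].
  have yst := supp_seq_cat t ys.
  have zst : supp_seq z (undup (s ++ t)).
    split=> [|x]; first exact: undup_uniq.
    by move=> /zt.2 xt; rewrite mem_undup mem_cat xt orbT.
  exists (undup (s ++ t)).
    split=> [|x]; first exact: undup_uniq.
    move=> yz; apply: contrapT => xst; apply: yz.
    have y0 : rprod_fun y x = 0 by apply: contrapT => /yst.2.
    have z0 : rprod_fun z x = 0 by apply: contrapT => /zst.2.
    by rewrite linearP /= pi_addE pi_scaleE y0 z0 scaler0 addr0.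
  rewrite (supp_seq_sum h ys yst) (supp_seq_sum h zt zst) scaler_sumr -big_split /=.
  apply: eq_bigr => x _; rewrite -linearP; congr (h x _).
- move=> y [s _ ->]; rewrite big1 // => x _.
  by rewrite (linear0 (h x)).
- move=> y; have [s sP] := supp_seq_exists y.
  by exists (\sum_(x <- s) h x (rprod_fun y x)); exists s.
exists H => x a; have [s [s_uniq sP] ->] := HG (delta x a).
rewrite (supp_seq_sum h (t := [:: x])) //; last first.
  split=> // i; rewrite inE rprod_ofE /delta_fun; case: eqP => //.
by rewrite big_seq1 rprod_ofE /delta_fun eqxx.
Qed.

End DirectSum.

Lemma divisible_dsum (R : idomainType) (X : choiceType) (A : lmodType R) :
  divisible A -> divisible (dsum X A).
Proof. by move=> Adiv; apply: divisible_rprod. Qed.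

Lemma torsion_free_dsum (R : idomainType) (X : choiceType) (A : lmodType R) :
  torsion_free A -> torsion_free (dsum X A).
Proof. by move=> Atf; apply/torsion_free_sub/torsion_free_pi. Qed.

Section Free.
Variable R : comNzRingType.
Implicit Types M : lmodType R.

Definition free (X : choiceType) : lmodType R := dsum X (R^o : lmodType R).

Lemma free_lift (X : choiceType) M (m : X -> M) :
  exists h : {linear free X -> M}, forall x, h (delta x (1 : R^o)) = m x.
Proof.
have m_lin x : linear (fun r : R^o => r *: m x).
  by move=> k u v; rewrite scalerDl scalerA.
have [h hE] := dsum_lift (fun x => linear_map (m_lin x)).
by exists h => x; rewrite hE linear_mapE scale1r.
Qed.

Lemma free_ext (X : choiceType) M (f g : {linear free X -> M}) :
  (forall x, f (delta x (1 : R^o)) = g (delta x (1 : R^o))) -> forall y, f y = g y.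
Proof.
move=> fg; apply: dsum_ext => x a.
have -> : delta x a = (a : R) *: delta x (1 : R^o) by rewrite -linearZ /= /GRing.scale /= mulr1.
by rewrite !linearZ /= fg.
Qed.

Lemma free_projective (X : choiceType) : projective_module (free X).
Proof.
move=> A B p f psurj.
have [a aP] := choice (fun x => psurj (f (delta x (1 : R^o)))).
have [g gE] := free_lift a; exists g => y.
pose pg := linear_map (f := p \o g) (fun k u v => linearP (p \o g) k u v).
by rewrite -[p (g y)]/(pg y); apply: free_ext => x; rewrite /= gE aP.
Qed.

Lemma free_cover_exists M : {h : {linear free M -> M} | forall x, h (delta x (1 : R^o)) = x}.
Proof. by apply: cid; exact: (free_lift (fun x : M => x)). Qed.

(** The generators are the elements of M themselves, so that iterating on kernels
    yields a resolution without further choices. *)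
Definition free_cover M : {linear free M -> M} := sval (free_cover_exists M).

Lemma free_cover_surj M (m : M) : exists x, free_cover M x = m.
Proof. by exists (delta m (1 : R^o)); rewrite /free_cover; case: free_cover_exists. Qed.

Fixpoint syzygy M n : lmodType R :=
  if n is n'.+1 then sub_module (kernel (free_cover (syzygy M n'))) else M.

Definition free_diff M n : {linear free (syzygy M n.+1) -> free (syzygy M n)} :=
  @subval _ _ _ \o free_cover (syzygy M n.+1).

Lemma free_diff_range M n x :
  free_cover (syzygy M n) x = 0 <-> exists y, free_diff M n y = x.
Proof.
split=> [x0|[y <-]]; last exact: subvalP (free_cover (syzygy M n.+1) y).
have [y yE] := free_cover_surj (SubModule (x0 : kernel _ x) : syzygy M n.+1).
by exists y; rewrite /= yE.
Qed.

Lemma free_diff_kernel M n x :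
  free_diff M n x = 0 <-> free_cover (syzygy M n.+1) x = 0.
Proof. by split=> [x0|x0]; [apply: subval_inj | rewrite /= x0]. Qed.

Lemma projective_resolution_exists M : inhabited (projective_resolution M).
Proof.
split; apply: (@ProjectiveResolution R M (fun n => free (syzygy M n))
  (free_diff M) (free_cover M)).
- by move=> n; exact: free_projective.
- move=> n x; exact: iff_trans (free_diff_kernel _) (free_diff_range _).
- by move=> x; exact: free_diff_range M 0 x.
- exact: free_cover_surj.
Qed.

End Free.
(** * Embeddings into divisible modules *)

Section Embeddings.
Variable R : idomainType.
Implicit Types C F : lmodType R.

Definition frac_embed_fun (r : R) : frac_module R := FracField.tofrac r.
Fact frac_embed_linear : linear (frac_embed_fun : R^o -> frac_module R).
Proof.
move=> k u v; rewrite frac_scaleE /frac_embed_fun -tofracM.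
exact: tofracD.
Qed.

Definition frac_embed : {linear R^o -> frac_module R} := linear_map frac_embed_linear.

Lemma frac_embed_eq0 (r : R) : (frac_embed r = 0) -> r = 0.
Proof. by move=> /eqP; rewrite tofrac_eq0 => /eqP. Qed.

Lemma frac_moduleP (z : frac_module R) :
  exists2 ab : R * R, ab.2 != 0 & ab.2 *: z = frac_embed ab.1.
Proof.
have [[a b] /= b0 ->] := frac_exists z; exists (a, b) => //=.
by rewrite frac_scaleE mulrC mulfVK // tofrac_eq0.
Qed.

Definition free_frac_embed (X : choiceType) :
    {linear free R X -> dsum X (frac_module R)} :=
  rprod_map (F := finite_supports X) (fun _ : X => frac_embed).

Lemma free_frac_embed_inj X : injective (@free_frac_embed X).
Proof.
apply: linear_injective => x x0; apply: rprod_eqP => i; apply: frac_embed_eq0.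
exact: (congr1 (fun y => rprod_fun y i) x0).
Qed.

(** If C = R^(C) / H then C is contained in K^(C) / H. *)
Lemma divisible_embedding C :
  exists (E : lmodType R) (i : {linear C -> E}), divisible E /\ injective i.
Proof.
pose s := free_cover C; pose j := @free_frac_embed C.
pose jk : {linear sub_module (kernel s) -> _} := j \o @subval _ _ (kernel s).
pose p := quot_pi (range jk).
have [||i iE] := @linear_factor_surj _ _ _ _ s (p \o j).
- exact: free_cover_surj.
- by move=> x sx; apply/quot_pi0; exists (SubModule (sx : kernel s x)).
exists (quot_module (range jk)), i; split.
  by apply/divisible_quot/divisible_dsum/frac_module_divisible.
apply: linear_injective => c; have [x <-] := free_cover_surj c.
by rewrite iE => /quot_pi0[y] /free_frac_embed_inj <-; exact: subvalP y.
Qed.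

(** Write F = R^(F) / H.  The subspace K H of K^(F) is divisible, hence a direct
    summand, and H is the intersection of K H with R^(F) because F is
    torsion-free.  A projection of kernel K H embeds F. *)
Lemma torsion_free_embedding F : dedekind R -> torsion_free F ->
  exists t : {linear F -> dsum F (frac_module R)}, injective t.
Proof.
move=> hR Ftf; pose s := free_cover F; pose j := @free_frac_embed F.
pose V := dsum F (frac_module R).
have Vtf : torsion_free V by apply/torsion_free_dsum/frac_module_torsion_free.
have Vdiv : divisible V by apply/divisible_dsum/frac_module_divisible.
(* N is K H for the kernel H of s *)
pose N (x : V) := exists a h, [/\ a != 0, s h = 0 & a *: x = j h].
have N0 : N 0 by exists 1, 0; rewrite oner_neq0 !linear0.
have NP k x y : N x -> N y -> N (k *: x + y).
  move=> [a [g [a0 sg ax]]] [b [h [b0 sh bx]]].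
  exists (a * b), ((k * b) *: g + a *: h); split; first exact: mulf_neq0.
    by rewrite linearP linearZ /= sg sh !scaler0 addr0.
  have -> : j ((k * b) *: g + a *: h) = (k * b) *: j g + a *: j h.
    by rewrite linearP linearZ.
  rewrite -ax -bx scalerDr !scalerA; congr (_ *: _ + _).
  by rewrite mulrC (mulrC a) mulrA.
pose NM := Submodule N0 NP.
have Ndiv : divisible (sub_module NM).
  move=> a [x [b [h [b0 sh bx]]]] a0; have [y ay] := Vdiv a x a0.
  have Ny : NM y.
    by exists (b * a), h; rewrite mulf_neq0 // -scalerA ay.
  by exists (SubModule Ny); apply: subval_inj.
have [|r rE] := divisible_extends hR (f := @subval _ _ NM) (g := idfun) Ndiv.
  by move=> a a0; apply: subval_inj.
have e_lin : linear (fun x => x - subval (r x)).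
  move=> k x y.
  have -> : subval (r (k *: x + y)) = k *: subval (r x) + subval (r y) by rewrite linearP.
  by rewrite opprD addrACA scalerBr.
(* e is a projection with kernel N *)
pose e : {linear V -> V} := linear_map e_lin.
have [||t tE] := @linear_factor_surj _ _ _ _ s (e \o j).
- exact: free_cover_surj.
- move=> x sx /=; have Njx : NM (j x) by exists 1, x; rewrite oner_neq0 scale1r.
  by rewrite /= -[j x in X in _ - X]/(subval (SubModule Njx)) rE subrr.
exists t; apply: linear_injective => c; have [x <-] := free_cover_surj c.
rewrite tE => /subr0_eq jx.
have {jx} jx : subval (r (j x)) = j x by [].
have [a [h [a0 sh ajx]]] : NM (j x) by rewrite -jx; exact: subvalP.
apply: Ftf a0 _; rewrite -linearZ.
suff -> : a *: x = h by [].
by apply: free_frac_embed_inj; rewrite linearZ.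
Qed.

End Embeddings.

(** * Flatness *)

Section TensorRules.
Variables (R : comNzRingType) (A B : lmodType R).
Implicit Types (a : A) (b : B).

Lemma tensDl a a' b : tens (a + a') b = tens a b + tens a' b.
Proof. by rewrite tens_piD; apply/tens_eqP; exact: tens_Dl. Qed.

Lemma tensDr a b b' : tens a (b + b') = tens a b + tens a b'.
Proof. by rewrite tens_piD; apply/tens_eqP; exact: tens_Dr. Qed.

Lemma tensZ r a b : tens (r *: a) b = tens a (r *: b).
Proof. by apply/tens_eqP; exact: tens_Z. Qed.

Lemma tens0l b : tens 0 b = 0 :> tensor A B.
Proof. by apply/tens_eqP; exact: tens_0l. Qed.

Lemma tens0r a : tens a 0 = 0 :> tensor A B.
Proof. by rewrite -(scale0r 0) -tensZ scale0r tens0l. Qed.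

Lemma tens_pi_cons a b s :
  \pi_(tensor A B) ((a, b) :: s) = tens a b + \pi_(tensor A B) s.
Proof. by rewrite tens_piD. Qed.

End TensorRules.

Section Flatness.
Variable R : idomainType.
Implicit Types A B F V M : lmodType R.

Lemma flat_torsion_free F : flat F -> torsion_free F.
Proof.
move=> Fflat a x a0 ax.
have mul_lin : linear (fun r : R^o => r * a : R^o).
  by move=> k u v; rewrite /= mulrDl -mulrA.
have mul_inj : injective (linear_map mul_lin) by move=> u v; exact: (mulIf a0).
have scale_lin1 (r : R^o) : linear (fun y : F => (r : R) *: y).
  by move=> k u v; rewrite scalerDr !scalerA mulrC.
have scale_lin2 (y : F) : linear (fun r : R^o => (r : R) *: y).
  by move=> k u v; rewrite scalerDl scalerA.
have [g gE _] := @tensor_universal R R^o F F _ scale_lin1 scale_lin2.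
have tx : tens (1 : R^o) x = 0.
  apply: (Fflat _ _ _ mul_inj); rewrite tensor_mapE linear0 linear_mapE mul1r.
  have -> : a = a *: (1 : R^o) by rewrite /GRing.scale /= mulr1.
  by rewrite tensZ ax tens0r.
by rewrite -[x]scale1r -gE tx linear0.
Qed.

(** Recursion on the list, instead of a family of coefficients, matches the
    recursion of tens_absorb on lists of pure tensors. *)
Fixpoint in_span V (s : seq V) (x : V) : Prop :=
  if s is v :: s' then exists c, in_span s' (x - c *: v) else x = 0.

Lemma in_span0 V (s : seq V) : in_span s 0.
Proof. by elim: s => [//|v s IH] /=; exists 0; rewrite scale0r subr0. Qed.

Lemma in_spanP V (s : seq V) k x y :
  in_span s x -> in_span s y -> in_span s (k *: x + y).
Proof.
elim: s x y => [|v s IH] x y /=; first by move=> -> ->; rewrite scaler0 addr0.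
move=> [c xc] [d yd]; exists (k * c + d).
have -> : k *: x + y - (k * c + d) *: v = k *: (x - c *: v) + (y - d *: v).
  by rewrite scalerBr scalerDl opprD addrACA -scalerA.
exact: IH.
Qed.

Definition span V (s : seq V) : submodule V := Submodule (in_span0 s) (@in_spanP V s).

Lemma in_span_mem V (s : seq V) v : v \in s -> in_span s v.
Proof.
elim: s => [//|w s IH]; rewrite inE => /predU1P[->|/IH vs] /=.
  by exists 1; rewrite scale1r subrr; exact: in_span0.
by exists 0; rewrite scale0r subr0.
Qed.

Lemma in_span_divide V (s : seq V) r (q : V -> V) x :
  torsion_free V -> r != 0 -> (forall v, r *: q v = v) ->
  in_span s (r *: x) -> in_span [seq q v | v <- s] x.
Proof.
move=> Vtf r0 rq; elim: s x => [|v s IH] x /=; first exact: Vtf.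
move=> [c cx]; exists c; apply: IH.
by rewrite scalerBr (scalerA r) mulrC -scalerA rq.
Qed.

(** A linear combination of the second factors of s can be distributed over the
    terms of s. *)
Lemma tens_absorb A V a (x : V) (s : seq (A * V)) :
  in_span [seq p.2 | p <- s] x ->
  exists2 t, size t = size s & tens a x + \pi_(tensor A V) s = \pi_(tensor A V) t.
Proof.
elim: s x => [|[b v] s IH] x /=; first by move=> ->; exists [::]; rewrite // tens0r add0r.
move=> [c /IH[t ts tE]]; exists ((b + c *: a, v) :: t); first by rewrite /= ts.
rewrite !tens_pi_cons -tE tensDl tensZ -[x in LHS](subrK (c *: v)) tensDr.
by rewrite !addrA; congr (_ + _); rewrite addrC [RHS]addrAC !addrA.
Qed.

Hypothesis hR : dedekind R.

(** The map r x + y |-> r on R x + N is well defined and extends because K is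
    injective. *)
Lemma non_torsion_functional M (N : submodule M) (x : M) :
  (forall r, N (r *: x) -> r = 0) ->
  exists f : {linear M -> frac_module R},
    (forall y, N y -> f y = 0) /\ f x = frac_embed R 1.
Proof.
move=> xN.
have phi_lin : linear (fun p : R^o * sub_module N => (p.1 : R) *: x + subval p.2).
  move=> k [r u] [t v] /=.
  by rewrite scalerDl -scalerA scalerDr addrACA.
have psi_lin : linear (fun p : R^o * sub_module N => frac_embed R p.1).
  by move=> k p q; exact: (linearP (frac_embed R)).
have [[r u] /= ru|f fE] := divisible_extends hR (f := linear_map phi_lin)
    (g := linear_map psi_lin) (@frac_module_divisible R).
  suff -> : r = 0 by exact: (linear0 (frac_embed R)).
  apply: xN; have -> : r *: x = - subval u by apply/eqP; rewrite -addr_eq0 ru.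
  exact/submoduleN/subvalP.
exists f; split=> [y Ny|].
  have : f ((0 : R) *: x + y) = frac_embed R 0 := fE (0, SubModule Ny).
  by rewrite scale0r add0r linear0.
have : f ((1 : R) *: x + 0) = frac_embed R 1 := fE (1, 0).
by rewrite scale1r addr0.
Qed.

(** Shorten a vanishing image of sum a_i (x) v_i one term at a time.  If the v_i
    are dependent over R, divisibility of V lets one term be absorbed by the
    others.  Otherwise some functional to K is 1 on the first v_i and 0 on the
    rest, which forces f a, hence a, to be torsion for the first a; then
    a (x) v = 0, since v is divisible by the element killing a. *)
Lemma torsion_free_divisible_flat V : torsion_free V -> divisible V -> flat V.
Proof.
move=> Vtf Vdiv A B f fI; apply: linear_injective; elim/tens_piW=> s.
have [n] := ubnP (size s); elim: n s => // n IH [//|[a v] s] /= sn fs.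
have [[r [r0 rv]]|indep] := pselect (exists r, r != 0 /\ in_span [seq p.2 | p <- s] (r *: v)).
  have [q qE] := choice (fun v => Vdiv r v r0).
  pose s' := [seq (r *: p.1, q p.2) | p <- s].
  have s'E : \pi_(tensor A V) s' = \pi_(tensor A V) s.
    rewrite !tens_piE big_map; apply: eq_bigr => p _.
    by rewrite /= tensZ qE.
  have [|t ts tE] := @tens_absorb A V a v s'.
    rewrite -map_comp (map_comp q (fun p => p.2)).
    exact: in_span_divide qE rv.
  have e : \pi_(tensor A V) ((a, v) :: s) = \pi_(tensor A V) t.
    by rewrite tens_pi_cons -s'E tE.
  by rewrite e; apply: IH; [rewrite ts size_map | rewrite -e].
have [r [r0 ra]] : exists r, r != 0 /\ r *: f a = 0.
  apply: contrapT => fa.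
  have [|phi [phi0 phi1]] := @non_torsion_functional V (span [seq p.2 | p <- s]) v.
    move=> r rv; apply: contrapT => r0; apply: indep.
    by exists r; split => //; apply/eqP.
  have [|chi [_ chi1]] := @non_torsion_functional B (span [::]) (f a).
    move=> r rfa; apply: contrapT => r0; apply: fa.
    by exists r; split => //; apply/eqP.
  pose h b w : frac_module R := (chi b : {fraction R}) * (phi w : {fraction R}).
  have h1 b : linear (h b).
    move=> k x y; rewrite /h linearP mulrDr; congr (_ + _).
    by rewrite !frac_scaleE mulrCA.
  have h2 w : linear (h^~ w).
    move=> k x y; rewrite /h linearP mulrDl; congr (_ + _).
    by rewrite !frac_scaleE mulrA.
  have [g gE _] := tensor_universal h1 h2.
  have := congr1 g fs; rewrite linear0 tens_pi_cons linearD linearD.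
  rewrite tensor_mapE gE tens_piE !linear_sum big_seq big1 => [|p ps].
    rewrite addr0 /h phi1 chi1 /= /frac_embed_fun tofrac1 mulr1 => /eqP.
    by rewrite oner_eq0.
  rewrite tensor_mapE gE /h phi0 ?mulr0 //.
  by apply: in_span_mem; exact: map_f.
have a0 : r *: a = 0 by apply: fI; rewrite linearZ linear0.
have e : \pi_(tensor A V) ((a, v) :: s) = \pi_(tensor A V) s.
  have [w wE] := Vdiv r v r0.
  by rewrite tens_pi_cons -wE -tensZ a0 tens0l add0r.
by rewrite e; apply: IH => //; rewrite -e.
Qed.

End Flatness.
(** * Cotorsion modules *)

Section ShortExact.
Variable R : comNzRingType.

Definition short_exact (C E E' : lmodType R) (i : {linear C -> E}) (f : {linear E -> E'}) :=
  [/\ injective i, exact_at i f & forall y, exists x, f x = y].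

Lemma quot_short_exact (C E : lmodType R) (i : {linear C -> E}) :
  injective i -> short_exact i (quot_pi (range i)).
Proof.
move=> i_inj; split=> //; last exact: quot_pi_surj.
by move=> x; exact: quot_pi0.
Qed.

(** Lift g along a projective resolution of V.  The obstruction to descending
    the lift to V is a 1-cocycle with values in C, hence a coboundary, by which
    the lift is corrected. *)
Lemma cotorsion_lift (C E E' V : lmodType R) (i : {linear C -> E}) (f : {linear E -> E'})
    (g : {linear V -> E'}) :
  cotorsion C -> short_exact i f -> flat V ->
  exists h : {linear V -> E}, forall v, f (h v) = g v.
Proof.
move=> Ccot [i_inj i_exact f_surj] /Ccot CV.
have [P] := projective_resolution_exists V.
have [k kE] := @res_projective _ _ P 0 _ _ f (g \o aug P) f_surj.
have aug_diff x : aug P (diff P 0 x) = 0 by apply/res_exact0; exists x.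
have [|phi phiE] := @linear_factor_inj _ _ _ _ i (k \o diff P 0) i_inj.
  by move=> x; apply/i_exact; rewrite /= kE /= aug_diff linear0.
have [|gam gamE] := CV P phi.
  move=> x; apply: (linear_injective0 i_inj); rewrite phiE /=.
  suff -> : diff P 0 (diff P 1 x) = 0 by rewrite linear0.
  by apply/(@res_exact _ _ P 0); exists x.
have [||h hE] := @linear_factor_surj _ _ _ _ (aug P) (k \- (i \o gam)).
- exact: aug_surj.
- by move=> _ /res_exact0[x <-]; rewrite /= -gamE phiE subrr.
exists h => v; have [x <-] := aug_surj P v.
rewrite hE /= linearB kE /=.
suff -> : f (i (gam x)) = 0 by rewrite subr0.
by apply/i_exact; exists (gam x).
Qed.

Lemma cotorsion_retract (C L : lmodType R) (s : {linear C -> L}) (r : {linear L -> C}) :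
  (forall c, r (s c) = c) -> cotorsion L -> cotorsion C.
Proof.
move=> rs Lcot F Fflat P f f0.
have [|g gE] := Lcot F Fflat P (s \o f); first by move=> x; rewrite /= f0 linear0.
by exists (r \o g) => x; rewrite /= -gE rs.
Qed.

End ShortExact.

Section Cotorsion.
Variable R : idomainType.
Implicit Types C E F V : lmodType R.

(** This is Ext^1(V, C) = 0 for all K-vector spaces V, computed by means of one
    coresolution of C by divisible modules instead of resolutions of the V. *)
Definition Matlis_cotorsion C := exists (E E' : lmodType R)
    (i : {linear C -> E}) (f : {linear E -> E'}),
  [/\ divisible E, short_exact i f &
      forall V (g : {linear V -> E'}), torsion_free V -> divisible V ->
      exists h : {linear V -> E}, forall v, f (h v) = g v].

Lemma divisible_surj E E' (f : {linear E -> E'}) :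
  (forall y, exists x, f x = y) -> divisible E -> divisible E'.
Proof.
move=> f_surj Ediv a y a0; have [x <-] := f_surj y; have [z <-] := Ediv a x a0.
by exists (f z); rewrite linearZ.
Qed.

(** Multiplication by a is 0 on Ext^1(V, C) since it kills C, and bijective since
    it is so on V.  Concretely, the lift of g v is a times any preimage of
    g (v / a). *)
Lemma bounded_Matlis_cotorsion C (a : R) : a != 0 -> (forall c : C, a *: c = 0) ->
  Matlis_cotorsion C.
Proof.
move=> a0 aC; have [E [i [Ediv i_inj]]] := divisible_embedding C.
pose f : {linear E -> _} := quot_pi (range i); have se := quot_short_exact i_inj.
exists E, (quot_module (range i)), i, f; split=> // V g Vtf Vdiv.
have [_ i_exact f_surj] := se.
pose G v y := exists w e, [/\ a *: w = v, f e = g w & y = a *: e].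
have [|||h hG] := @linear_of_graph R V E G.
- move=> k _ _ _ _ [v [d [<- fd ->]]] [w [e [<- fe ->]]].
  exists (k *: v + w), (k *: d + e); split.
  + by rewrite scalerDr !scalerA mulrC.
  + by rewrite (linearP f) fd fe (linearP g).
  + by rewrite scalerDr !scalerA mulrC.
- move=> _ [w [e [/(Vtf _ _ a0) -> fe ->]]].
  have /i_exact[c <-] : f e = 0 by rewrite fe linear0.
  by rewrite -linearZ /= aC linear0.
- move=> v; have [w wv] := Vdiv a v a0; have [e fe] := f_surj (g w).
  by exists (a *: e), w, e.
exists h => v; have [w [e [<- fe ->]]] := hG v.
by rewrite (linearZ_LR g) -fe -(linearZ_LR f).
Qed.

Hypothesis hR : dedekind R.

Lemma cotorsion_Matlis C : cotorsion C -> Matlis_cotorsion C.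
Proof.
move=> Ccot; have [E [i [Ediv i_inj]]] := divisible_embedding C.
exists E, (quot_module (range i)), i, (quot_pi (range i)).
have se := quot_short_exact i_inj; split=> // V g Vtf Vdiv.
by apply: cotorsion_lift se _ => //; exact: torsion_free_divisible_flat.
Qed.

(** A 1-cocycle of F with values in C gives g0 : F -> E / C, which extends to
    K^(F) as E / C is divisible.  Lifting the extension to E shows that the
    cocycle is a coboundary. *)
Lemma Matlis_cotorsion_cotorsion C : Matlis_cotorsion C -> cotorsion C.
Proof.
move=> [E [E' [i [f [Ediv [i_inj i_exact f_surj] lift]]]]] F /flat_torsion_free Ftf P phi phi0.
have [x dx|k kE] := divisible_extends hR (f := diff P 0) (g := i \o phi) Ediv.
  have /(@res_exact _ _ P 0)[y <-] : diff P 0 x = 0 by [].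
  by rewrite /= phi0 linear0.
have fi c : f (i c) = 0 by apply/i_exact; exists c.
have [||g0 g0E] := @linear_factor_surj _ _ _ _ (aug P) (f \o k).
- exact: aug_surj.
- by move=> _ /res_exact0[x <-]; rewrite /= kE fi.
have [j j_inj] := torsion_free_embedding hR Ftf.
have [|g gE] := divisible_extends hR (f := j) (g := g0) (divisible_surj f_surj Ediv).
  by move=> x /(linear_injective0 j_inj) ->; rewrite linear0.
have [||h hE] := lift _ g.
- exact/torsion_free_dsum/frac_module_torsion_free.
- exact/divisible_dsum/frac_module_divisible.
have [x|gam gamE] := @linear_factor_inj _ _ _ _ i (k \- (h \o j \o aug P)) i_inj.
  by apply/i_exact; rewrite /= linearB hE gE g0E subrr.
exists gam => x; apply: i_inj.
have aug_diff : aug P (diff P 0 x) = 0 by apply/res_exact0; exists x.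
by rewrite gamE /= kE aug_diff (linear0 j) (linear0 h) subr0.
Qed.

End Cotorsion.
(** * Towers of divisible modules *)

Section InverseLimitMaps.
Variables (R : comNzRingType) (I : nat -> lmodType R) (p : forall n, {linear I n.+1 -> I n}).

Definition invlim_proj n (x : invlim p) : I n := Defs.coord x n.
Fact invlim_proj_linear n : linear (invlim_proj n). Proof. by []. Qed.
HB.instance Definition _ n :=
  GRing.isLinear.Build R (invlim p) (I n) *:%R (invlim_proj n) (invlim_proj_linear n).

Lemma invlim_lift (C : lmodType R) (h : forall n, {linear C -> I n}) :
  (forall n x, p n (h n.+1 x) = h n x) ->
  exists H : {linear C -> invlim p}, forall x n, Defs.coord (H x) n = h n x.
Proof.
move=> hP; pose H x := InvLim (fun n => hP n x).
have H_lin : linear H by move=> a x y; apply: invlim_eqP => n; exact: linearP.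
by exists (linear_map H_lin).
Qed.

End InverseLimitMaps.

Section TowerRetract.
Variable R : comNzRingType.
Implicit Types C D L : lmodType R.

Lemma lmod_iso_inverse C D : lmod_iso C D ->
  exists (f : {linear C -> D}) (g : {linear D -> C}), cancel f g /\ cancel g f.
Proof.
move=> [f [g fK gK]]; exists f.
have g_lin : linear g.
  by move=> a x y; apply: (can_inj fK); rewrite gK linearP !gK.
by exists (linear_map g_lin).
Qed.

Lemma retract_iso C L (s : {linear C -> L}) (r : {linear L -> C}) :
  (forall c, r (s c) = c) -> lmod_iso L (C * sub_module (kernel r))%type.
Proof.
move=> rs.
have kerP x : kernel r (x - s (r x)) by rewrite /= linearB rs subrr.
have f_lin : linear (fun x => (r x, SubModule (kerP x))).
  move=> a x y; congr pair; first exact: linearP.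
  by apply: subval_inj; exact: (linearP (idfun \- (s \o r))).
exists (linear_map f_lin); exists (fun y => s y.1 + subval y.2).
  by move=> x; rewrite linear_mapE /= addrC subrK.
move=> [c [y ry]]; rewrite linear_mapE /=.
have e : r (s c + y) = c by rewrite linearD rs [r y]ry addr0.
congr pair; first by [].
by apply: subval_inj; rewrite /= e addrC addKr.
Qed.

(** The complement is the kernel of the retraction, so only the maps matter. *)
Lemma classC_retractP C : classC C <->
  exists (I : nat -> lmodType R) (p : forall n, {linear I n.+1 -> I n}),
    [/\ forall n, injective_module (I n), forall n y, exists x, p n x = y &
        exists (s : {linear C -> invlim p}) (r : {linear invlim p -> C}),
          forall c, r (s c) = c].
Proof.
split=> [[L [D [[I [p [Iinj psurj Liso]]] Ciso]]]|[I [p [Iinj psurj [s [r rs]]]]]].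
  exists I, p; split=> //.
  have [f [f' [fK f'K]]] := lmod_iso_inverse Liso.
  have [g [g' [gK g'K]]] := lmod_iso_inverse Ciso.
  have in_lin : linear (fun c : C => (c, 0) : C * D).
    by move=> a x y; congr pair; rewrite -[RHS]/(a *: (0 : D) + 0) scaler0 addr0.
  have pr_lin : linear (fun x : C * D => x.1) by [].
  exists (f \o g' \o linear_map in_lin), (linear_map pr_lin \o g \o f') => c.
  by rewrite /= fK g'K.
exists (invlim p), (sub_module (kernel r)); split; last exact: retract_iso rs.
exists I, p; split=> //; exists idfun.
by exists id.
Qed.

End TowerRetract.

Section VectorSpaceCover.
Variable R : idomainType.
Hypothesis hR : dedekind R.

(** W is Hom(K, E) and q the evaluation at 1, which is onto since E is injective. *)
Lemma vector_space_cover (E : lmodType R) : divisible E ->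
  exists (W : lmodType R) (q : {linear W -> E}),
    [/\ torsion_free W, divisible W & forall y, exists w, q w = y].
Proof.
move=> Ediv; pose K := frac_module R.
pose hom (w : pi_module (fun _ : K => E)) := linear (w : K -> E).
have hom0 : hom 0.
  by move=> a x y; rewrite -[LHS]/(0 : E) -[RHS]/(a *: (0 : E) + 0) scaler0 addr0.
have homP k v w : hom v -> hom w -> hom (k *: v + w).
  move=> hv hw a x y; rewrite !pi_addE !pi_scaleE hv hw !scalerDr !scalerA mulrC.
  by rewrite addrACA.
pose W := sub_module (Submodule hom0 homP).
have q_lin : linear (fun w : W => subval w (frac_embed R 1)) by [].
have homZ (w : W) a x : subval w (a *: x) = a *: subval w x.
  have w_lin : linear (subval w : K -> E) := subvalP w.
  exact: linearZ_LR (linear_map w_lin) a x.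
exists W, (linear_map q_lin); split.
- move=> a w a0 aw; apply: subval_inj; apply: pi_eqP => x.
  have [z <-] := frac_module_divisible x a0.
  by rewrite homZ -pi_scaleE -linearZ aw.
- move=> a w a0.
  have [d dE] := choice (fun x : K => frac_module_divisible x a0).
  have d_lin : linear d.
    move=> k x y; apply: (torsion_free_scale_inj (@frac_module_torsion_free R) a0).
    by rewrite dE scalerDr (scalerA a) mulrC -scalerA !dE.
  have wd_lin : hom (subval w \o d).
    by move=> k x y; rewrite /= d_lin (subvalP w).
  exists (@SubModule _ _ (Submodule hom0 homP) _ wd_lin).
  by apply: subval_inj; apply: pi_eqP => x; rewrite /= pi_scaleE /= -homZ dE.
- move=> y.
  have y_lin : linear (fun r : R^o => (r : R) *: y).
    by move=> k u v; rewrite scalerDl scalerA.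
  have [x /frac_embed_eq0 ->|h hE] :=
    divisible_extends hR (f := frac_embed R) (g := linear_map y_lin) Ediv.
    by rewrite linear0.
  have h_lin : hom h by move=> a u v; exact: linearP.
  exists (@SubModule _ _ (Submodule hom0 homP) _ h_lin).
  by rewrite linear_mapE /= -[LHS]/(h (frac_embed R 1)) hE linear_mapE scale1r.
Qed.

End VectorSpaceCover.

Section Tower.
Variables (R : idomainType) (E E' W : lmodType R).
Variables (f : {linear E -> E'}) (q : {linear W -> E'}).
Hypotheses (Ediv : divisible E) (E'div : divisible E') (Wdiv : divisible W).
Hypothesis q_surj : forall y, exists w, q w = y.

Let Ws := pi_module (fun _ : nat => W).
Let Es := pi_module (fun _ : nat => E').

(** For t = (x, w, u).  Beyond n the sequence u is free, which makes the stage
    divisible; that it vanishes eventually makes w = 0 imply f x = 0 in the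
    limit. *)
Definition stage_pred n (t : E * Ws * Es) :=
  [/\ t.2 0%N = f t.1.1, forall i, (i < n)%N -> t.2 i.+1 = t.2 i - q (t.1.2 i),
      forall i, (n <= i)%N -> t.1.2 i = 0 &
      exists m, forall i, (m <= i)%N -> t.2 i = 0].

Fact stage0 n : stage_pred n 0.
Proof.
split=> [|i _|//|]; last by exists 0%N.
  by rewrite -[LHS]/(0 : E') -[t in f t]/(0 : E) linear0.
by rewrite -[LHS]/(0 : E') -[RHS]/(0 - q 0 : E') linear0 subrr.
Qed.

Fact stageP n k s t : stage_pred n s -> stage_pred n t -> stage_pred n (k *: s + t).
Proof.
move: s t => [[x w] u] [[y v] z] [/= s0 s1 s2 [m s3]] [/= t0 t1 t2 [m' t3]]; split=> /=.
- by rewrite pi_addE pi_scaleE s0 t0 linearP.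
- move=> i i_n; rewrite !pi_addE !pi_scaleE s1 // t1 // linearP opprD addrACA.
  by rewrite scalerBr.
- by move=> i n_i; rewrite pi_addE pi_scaleE s2 // t2 // scaler0 addr0.
- exists (maxn m m') => i; rewrite geq_max => /andP[mi m'i].
  by rewrite pi_addE pi_scaleE s3 // t3 // scaler0 addr0.
Qed.

Definition stage n : lmodType R := sub_module (Submodule (stage0 n) (@stageP n)).

Definition truncate n (w : Ws) : Ws := fun i => if (i < n)%N then w i else 0.

Fact truncate_linear n : linear (truncate n).
Proof.
move=> k v w; apply: pi_eqP => i; rewrite pi_addE pi_scaleE /truncate.
by case: ifP => // _; rewrite scaler0 addr0.
Qed.

Fact stage_truncate n (t : stage n.+1) :
  stage_pred n ((subval t).1.1, truncate n (subval t).1.2, (subval t).2).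
Proof.
case: t => [[[x w] u] [/= t0 t1 t2 t3]]; split=> //= i i_n; rewrite /truncate.
  by rewrite i_n t1 // ltnW.
by rewrite ltnNge i_n.
Qed.

Definition stage_map_fun n (t : stage n.+1) : stage n :=
  @SubModule _ _ (Submodule (stage0 n) (@stageP n)) _ (stage_truncate t).

Fact stage_map_linear n : linear (@stage_map_fun n).
Proof.
move=> k s t; apply: subval_inj; congr (_, _, _).
exact: truncate_linear.
Qed.

Definition stage_map n : {linear stage n.+1 -> stage n} := linear_map (@stage_map_linear n).

Lemma stage_map_surj n y : exists x, stage_map n x = y.
Proof.
case: y => [[[x w] u] t]; have [/= t0 t1 t2 t3] := t.
(* the new equation, at i = n, prescribes q w_n *)
have [wn wnE] := q_surj (u n - u n.+1).
pose w' : Ws := fun i => if i == n then wn else w i.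
have t' : stage_pred n.+1 (x, w', u).
  split=> //= i; rewrite ?ltnS /w'.
    have [->|i_n] := eqVneq i n; first by rewrite wnE subKr.
    by rewrite leq_eqVlt (negbTE i_n) => /t1.
  by move=> n_i; rewrite gtn_eqF // t2 // ltnW.
exists (@SubModule _ _ (Submodule (stage0 n.+1) (@stageP n.+1)) _ t').
apply: subval_inj; congr (_, _, _); apply: pi_eqP => i; rewrite /truncate /=.
case: ltnP => [i_n|/t2 //]; by rewrite /w' ltn_eqF.
Qed.

(** Dividing x and w determines the first n + 1 terms of the quotient of u; the
    other terms are divided one by one, 0 by 0, to keep the support finite. *)
Lemma stage_divisible n : divisible (stage n).
Proof.
move=> a [[[x w] u] [/= t0 t1 t2 [m t3]]] a0.
have [x' xE] := Ediv x a0.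
have /choice[w' wE] : forall i, exists y : W, a *: y = w i /\ ((n <= i)%N -> y = 0).
  move=> i; case: (leqP n i) => [n_i|_].
    by exists 0; rewrite scaler0 t2.
  by have [y yE] := Wdiv (w i) a0; exists y.
have /choice[v vE] : forall i, exists y : E', a *: y = u i /\ (u i = 0 -> y = 0).
  move=> i; have [->|ui] := eqVneq (u i) 0; first by exists 0; rewrite scaler0.
  have [y yE] := E'div (u i) a0; exists y; split=> // ui0.
  by rewrite ui0 eqxx in ui.
(* the first n + 1 coordinates are determined by x' and w' *)
pose v1 i := f x' - \sum_(j < i) q (w' j).
have v1S i : v1 i.+1 = v1 i - q (w' i) by rewrite /v1 big_ord_recr /= opprD addrA.
have v1E i : (i <= n)%N -> a *: v1 i = u i.
  elim: i => [_|i IH i_n]; first by rewrite /v1 big_ord0 subr0 -linearZ /= xE t0.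
  by rewrite v1S scalerBr (IH (ltnW i_n)) t1 // -linearZ /= (wE i).1.
pose u' : Es := fun i => if (i <= n)%N then v1 i else v i.
have t' : stage_pred n (x', w', u').
  split=> /=.
  - by rewrite /u' /v1 big_ord0 subr0.
  - by move=> i i_n; rewrite /u' i_n (ltnW i_n) v1S.
  - by move=> i /(wE i).2.
  - exists (maxn m n.+1) => i; rewrite geq_max /u' => /andP[mi n_i].
    by rewrite leqNgt n_i; apply: (vE i).2; exact: t3.
exists (@SubModule _ _ (Submodule (stage0 n) (@stageP n)) _ t').
apply: subval_inj; congr (_, _, _) => //; apply: pi_eqP => i.
  exact: (wE i).1.
rewrite /= /u' pi_scaleE; case: ifP => [/v1E //|_]; exact: (vE i).1.
Qed.

Lemma stage_embed (C : lmodType R) (i : {linear C -> E}) : (forall c, f (i c) = 0) ->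
  exists s : {linear C -> invlim stage_map},
    forall c n, (subval (Defs.coord (s c) n)).1.1 = i c /\
                (subval (Defs.coord (s c) n)).1.2 = 0.
Proof.
move=> fi.
have sP n c : stage_pred n (i c, 0, 0).
  split=> //=; last by exists 0%N.
  by move=> j _; rewrite -[LHS]/(0 : E') -[RHS]/(0 - q 0 : E') linear0 subrr.
pose s n c : stage n := @SubModule _ _ (Submodule (stage0 n) (@stageP n)) _ (sP n c).
have s_lin n : linear (s n).
  move=> k x y; apply: subval_inj; congr (_, _, _); first exact: linearP.
  - by apply: pi_eqP => j; rewrite -[RHS]/(k *: (0 : W) + 0) scaler0 addr0.
  - by apply: pi_eqP => j; rewrite -[RHS]/(k *: (0 : E') + 0) scaler0 addr0.
have [|S SE] := @invlim_lift R stage stage_map C (fun n => linear_map (s_lin n)).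
  move=> n x; apply: subval_inj; congr (_, _, _); apply: pi_eqP => j.
  by rewrite /truncate; case: ifP.
by exists S => c n; rewrite SE.
Qed.

Definition stage_limit_w (z : invlim stage_map) : Ws :=
  fun i => (subval (Defs.coord z i.+1)).1.2 i.
Fact stage_limit_w_linear : linear stage_limit_w. Proof. by []. Qed.

Definition stage_limit_x (z : invlim stage_map) : E := (subval (Defs.coord z 0)).1.1.
Fact stage_limit_x_linear : linear stage_limit_x. Proof. by []. Qed.

(** All stages of a point of the limit share the same u.  For w = 0 it is
    constant, hence 0 as it vanishes eventually. *)
Lemma stage_limit_kernel z : stage_limit_w z = 0 -> f (stage_limit_x z) = 0.
Proof.
move=> w0.
pose t n := subval (Defs.coord z n).
have tP n : stage_pred n (t n) := subvalP (Defs.coord z n).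
have tS n : t n = ((t n.+1).1.1, truncate n (t n.+1).1.2, (t n.+1).2).
  by rewrite {1}/t -(Defs.coordP z n).
have xu n : (t n).1.1 = (t 0%N).1.1 /\ (t n).2 = (t 0%N).2.
  elim: n => [//|n [IHx IHu]]; rewrite -IHx -IHu.
  by rewrite (tS n).
have [m um] : exists m, forall i, (m <= i)%N -> (t 0%N).2 i = 0 by have [_ _ _] := tP 0%N.
have uS i : (t 0%N).2 i.+1 = (t 0%N).2 i.
  have [_ tu _ _] := tP i.+1; have := tu i (ltnSn i).
  rewrite (xu i.+1).2 => ->.
  by rewrite -[(t i.+1).1.2 i]/(stage_limit_w z i) w0 -[q _]/(q 0) linear0 subr0.
have u0 i : (t 0%N).2 i = (t 0%N).2 0%N by elim: i => [//|i <-].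
have [<- _ _ _] := tP 0%N.
by rewrite -(u0 m) um.
Qed.

End Tower.

Section ClassC.
Variable R : idomainType.
Hypothesis hR : dedekind R.

(** On the limit, f x depends only on w by stage_limit_kernel, so it extends to a
    map g on all sequences in W.  If h lifts g then x - h w lies in C, which
    is the retraction. *)
Lemma Matlis_cotorsion_classC (C : lmodType R) : Matlis_cotorsion C -> classC C.
Proof.
move=> [E [E' [i [f [Ediv [i_inj i_exact f_surj] lift]]]]].
have E'div := divisible_surj f_surj Ediv.
have [W [q [Wtf Wdiv q_surj]]] := vector_space_cover hR E'div.
apply/classC_retractP; exists (stage f q), (@stage_map _ _ _ _ f q); split.
- by move=> n; apply: divisible_injective => //; exact: stage_divisible.
- by move=> n; exact: stage_map_surj.
pose Ws := pi_module (fun _ : nat => W).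
pose w := linear_map (stage_limit_w_linear (f := f) (q := q)).
pose x := linear_map (stage_limit_x_linear (f := f) (q := q)).
have [z|g gE] := divisible_extends hR (f := w) (g := f \o x) E'div.
  exact: stage_limit_kernel.
have [||h hE] := lift Ws g.
- by apply: torsion_free_pi => _.
- by apply: divisible_pi => _.
have [z|r rE] := @linear_factor_inj _ _ _ _ i (x \- (h \o w)) i_inj.
  by apply/i_exact; rewrite /= linearB hE gE /= subrr.
have fi c : f (i c) = 0 by apply/i_exact; exists c.
have [s sE] := stage_embed q fi.
exists s, r => c; apply: i_inj; rewrite rE /=.
have -> : stage_limit_x (s c) = i c by have [] := sE c 0%N.
have -> : stage_limit_w (s c) = 0.
  by apply: pi_eqP => n; rewrite /stage_limit_w (sE c n.+1).2.
by rewrite linear0 subr0.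
Qed.

Lemma cotorsion_classC (C : lmodType R) : cotorsion C -> classC C.
Proof. by move=> /(cotorsion_Matlis hR); exact: Matlis_cotorsion_classC. Qed.

End ClassC.
(** * Products with countable supports *)

Section CountableSupports.
Variable T : Type.
Fact countable_smallU (A B : set T) : countable A -> countable B -> countable (A `|` B).
Proof.
by move=> Ac Bc; rewrite -bigcup2E; apply: bigcup_countable => // -[|[|n]] _ /=.
Qed.
Fact countable_smallS (A B : set T) : A `<=` B -> countable B -> countable A.
Proof. by move=> /subset_card_le; exact: sub_countable. Qed.
Definition countable_supports : support_ideal T :=
  SupportIdeal (@countable0 T) countable_smallU countable_smallS.
End CountableSupports.

Section CountableProduct.
Variables (R : comNzRingType) (T : Type).
Notation cprod := (rprod (countable_supports T)).

Section Limit.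
Variables (I : T -> nat -> lmodType R) (p : forall i n, {linear I i n.+1 -> I i n}).

Definition cprod_tower n : lmodType R := cprod (fun i => I i n).
Definition cprod_tower_map n : {linear cprod_tower n.+1 -> cprod_tower n} :=
  rprod_map (F := countable_supports T) (fun i => p i n).

Lemma cprod_tower_map_surj n : (forall i y, exists x, p i n x = y) ->
  forall y, exists x, cprod_tower_map n x = y.
Proof.
move=> psurj y.
have H i : exists x, p i n x = rprod_fun y i /\ (rprod_fun y i = 0 -> x = 0).
  have [->|yi] := pselect (rprod_fun y i = 0); first by exists 0; rewrite linear0.
  by have [x xE] := psurj i (rprod_fun y i); exists x.
have [x xE] := dependent_choice H.
have Fx : countable_supports T (supp (x : pi_module _)).
  by apply: smallS (rprodP y) => i /= xi yi; apply: xi; exact: (xE i).2.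
by exists (rprod_of Fx); apply: rprod_eqP => i; exact: (xE i).1.
Qed.

Fact cprod_limit_proj_subproof (z : invlim cprod_tower_map) i n :
  p i n (rprod_fun (Defs.coord z n.+1) i) = rprod_fun (Defs.coord z n) i.
Proof. by rewrite -(Defs.coordP z n). Qed.

Definition cprod_limit_proj i (z : invlim cprod_tower_map) : invlim (p i) :=
  InvLim (cprod_limit_proj_subproof z i).

Fact cprod_limit_proj_linear i : linear (cprod_limit_proj i).
Proof. by move=> a x y; exact: invlim_eqP. Qed.
HB.instance Definition _ i := GRing.isLinear.Build R (invlim cprod_tower_map)
  (invlim (p i)) *:%R (cprod_limit_proj i) (cprod_limit_proj_linear i).

(** A point of the limit vanishes at i if all its coordinates do, so its support
    is a countable union of countable sets. *)
Lemma cprod_limit_supp z : countable [set i | cprod_limit_proj i z <> 0].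
Proof.
apply: (@countable_smallS T _ (\bigcup_(n in [set: nat]) supp (rprod_fun (Defs.coord z n)))).
  move=> i /= zi; apply: contrapT => H; apply: zi; apply: invlim_eqP => n /=.
  by apply: contrapT => zn; apply: H; exists n.
apply: bigcup_countable => // n _; exact: (rprodP (Defs.coord z n)).
Qed.

End Limit.

End CountableProduct.
Section ClassCProduct.
Variables (R : idomainType) (T : Type).
Hypothesis hR : dedekind R.
Notation cprod := (rprod (countable_supports T)).

Lemma classC_cprod (C : T -> lmodType R) :
  (forall i, classC (C i)) -> classC (cprod C).
Proof.
move=> CC; have {}CC i := (classC_retractP (C i)).1 (CC i).
have [I /dependent_choice[p]] := dependent_choice CC.
move=> /all_and3[Iinj psurj /dependent_choice[s /dependent_choice[r rs]]].
have Idiv i n : divisible (I i n) by exact: injective_divisible.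
apply/classC_retractP; exists (cprod_tower I), (cprod_tower_map p); split.
- by move=> n; apply: divisible_injective => //; exact: divisible_rprod.
- by move=> n; apply: cprod_tower_map_surj => i; exact: psurj.
have [|S SE] := @invlim_lift R _ (cprod_tower_map p) (cprod C)
    (fun n => rprod_map (F := countable_supports T)
       (fun i => @invlim_proj R _ (p i) n \o s i)).
  by move=> n x; apply: rprod_eqP => i; exact: Defs.coordP.
have r_supp (z : invlim (cprod_tower_map p)) :
    countable_supports T (supp ((fun i => r i (cprod_limit_proj i z)) : pi_module C)).
  apply: countable_smallS (cprod_limit_supp z) => i /= rz z0; apply: rz.
  by rewrite z0 linear0.
have r_lin : linear (fun z => rprod_of (r_supp z)).
  by move=> a x y; apply: rprod_eqP => i; exact: (linearP (r i \o cprod_limit_proj i)).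
exists S, (linear_map r_lin) => c; apply: rprod_eqP => i.
rewrite linear_mapE rprod_ofE -[RHS]rs; congr (r i _).
by apply: invlim_eqP => n /=; rewrite SE.
Qed.

End ClassCProduct.

(** * Nonzero primes *)

Section Primes.
Variable R : idomainType.

Definition nonzero_primes : set (ideal R) :=
  [set J | prime_ideal J /\ nonzero_ideal J].

Lemma ideal_pred_inj : injective (@ideal_pred R).
Proof.
move=> J J' JJ'; apply: submodule_eqP => x.
have := congr1 (fun p : {pred R} => x \in p) JJ'; rewrite !ideal_predE => e.
by split=> /asboolP; [rewrite e | rewrite -e] => /asboolP.
Qed.

Lemma nonzero_primes_Spec J : nonzero_primes J -> Spec R (ideal_pred J).
Proof.
move=> [[J1 Jp] _]; split; first exact: ideal_pred_closed.
by move=> u v /asboolP /Jp[?|?]; apply/orP; [left|right]; apply/asboolP.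
Qed.

Lemma Spec_nonzero_primes (p : {pred R}) : Spec R p ->
  p = pred1 (0 : R) \/ exists2 J, nonzero_primes J & p = ideal_pred J.
Proof.
move=> [pid pprime].
have pE : p = ideal_pred (ideal_of_pred pid).
  by apply/funext => x; rewrite /ideal_pred /= asboolb.
have [Jnz|Jz] := pselect (nonzero_ideal (ideal_of_pred pid)).
  right; exists (ideal_of_pred pid) => //; split=> //; split=> /=.
    by case: (pid) => _ /negP.
  by move=> x y /pprime /orP.
left; apply/funext => x /=; apply/idP/eqP => [px|->].
  by apply: contrapT => x0; apply: Jz; exists x => //; apply/eqP.
by case: (pid).
Qed.

(** The zero ideal is the only prime left out. *)
Lemma countable_Spec : countable (Spec R) <-> countable nonzero_primes.
Proof.
split=> [/countable_injP[f f_inj]|Pc].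
  apply/countable_injP; exists (f \o @ideal_pred R) => J J' /set_mem JP /set_mem J'P e.
  by apply: ideal_pred_inj; apply: f_inj e; apply/mem_set; exact: nonzero_primes_Spec.
apply: (@countable_smallS _ _
  ([set pred1 (0 : R) : {pred R}] `|` (@ideal_pred R @` nonzero_primes))).
  move=> p /Spec_nonzero_primes[->|[J JP ->]]; first by left.
  by right; exists J.
apply: countable_smallU; first exact: finite_set_countable.
by apply: sub_countable Pc; exact: card_image_le.
Qed.

Hypothesis hR : dedekind R.

(** Let I be maximal among the ideals for which this fails.  It is not prime,
    since a nonzero prime is the only prime over itself.  So, unless I = R, it
    contains some x y but neither x nor y, and the primes over I are those over
    I + (x) or over I + (y). *)
Lemma finite_primes_over (I : ideal R) : nonzero_ideal I ->
  finite_set [set J | prime_ideal J /\ forall x, I x -> J x].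
Proof.
move=> I0; apply: contrapT => Iinf.
have {I I0 Iinf} [I [I0 Iinf] Imax] := ideal_maximal hR
  (P := fun I => nonzero_ideal I /\ ~ finite_set [set J | prime_ideal J /\ forall x, I x -> J x])
  (conj I0 Iinf).
apply: Iinf; have [I1|I1] := pselect (I 1).
  by apply: sub_finite_set (finite_set0 _) => J [[J1 _] IJ]; case: J1; exact: IJ.
have [Iprime|] := pselect (forall x y, I (x * y) -> I x \/ I y).
  apply: sub_finite_set (finite_set1 I) => J [[J1 _] IJ].
  apply: submodule_eqP => x; split; last exact: IJ.
  by apply: (prime_maximal hR (conj I1 Iprime)).
move=> /existsNP[x /existsNP[y /not_implyP[Ixy /not_orP[Ix Iy]]]].
have fin z : ~ I z ->
    finite_set [set J | prime_ideal J /\ forall x, add_principal I z x -> J x].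
  move=> Iz; apply: contrapT => zinf; apply: Iz.
  apply: (Imax (add_principal I z)); last exact: add_principal_gen.
    split=> //; have [w Iw w0] := I0.
    by exists w => //; exact: add_principalS.
  by move=> w; exact: add_principalS.
have : finite_set ([set J | prime_ideal J /\ forall z, add_principal I x z -> J z] `|`
                   [set J | prime_ideal J /\ forall z, add_principal I y z -> J z]).
  by rewrite finite_setU; split; exact: fin.
apply: sub_finite_set => J [Jprime IJ].
have JaddP z : J z -> forall w, add_principal I z w -> J w.
  by move=> Jz w [[u k] /= Iu ->]; apply: idealD; [exact: IJ | exact: idealM].
by have [Jx|Jy] := Jprime.2 _ _ (IJ _ Ixy); [left|right]; split=> //; exact: JaddP.
Qed.

Lemma countable_primes_containing (t : R) : t != 0 ->
  countable [set J | nonzero_primes J /\ J t].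
Proof.
move=> t0; apply: finite_set_countable.
have tnz : nonzero_ideal (colon t 1).
  by exists t => //; exists 1; rewrite mulr1 mul1r.
apply: sub_finite_set (finite_primes_over tnz) => J [[Jp _] Jt]; split=> // x [c].
by rewrite mulr1 => ->; exact: idealM.
Qed.

Lemma countable_primes_sequence : countable nonzero_primes ->
  exists b : nat -> R, (forall n, b n != 0) /\
    forall J, nonzero_primes J -> exists n, J (b n).
Proof.
move=> /countable_injP[g g_inj].
have /choice[b bP] : forall n, exists b, b != 0 /\
    forall J, nonzero_primes J -> g J = n -> J b.
  move=> n; have [[J [JP gJ]]|H] := pselect (exists J, nonzero_primes J /\ g J = n).
    have [_ [b Jb b0]] := JP; exists b; split=> // J' J'P gJ'.
    by rewrite (g_inj J' J) ?mem_set // gJ'.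
  exists 1; rewrite oner_neq0; split=> // J JP gJ; case: H; by exists J.
exists b; split=> [n|J JP]; first exact: (bP n).1.
by exists (g J); exact: (bP _).2.
Qed.

(** The t n are powers of products of elements chosen in the nonzero primes.  If
    s divided none of them, an ideal containing s and maximal among those
    avoiding every t n would be a nonzero prime, so some b n, and then t n.+1,
    would belong to it. *)
Lemma cofinal_divisors : countable nonzero_primes ->
  exists a t : nat -> R, [/\ forall n, t n != 0, forall n, t n.+1 = a n * t n &
    forall s, s != 0 -> exists n c, t n = c * s].
Proof.
move=> /countable_primes_sequence[b [b0 bP]].
pose B n := \prod_(i < n) b i; pose t n := B n ^+ n.
have B0 n : B n != 0 by apply/prodf_neq0 => i _.
have t0 n : t n != 0 by exact: expf_neq0.
have BD n m : exists c, B (n + m)%N = c * B n.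
  by exists (\prod_(i < m) b (n + i)%N); rewrite /B big_split_ord mulrC.
have tD n m : exists c, t (n + m)%N = c * (t n * t m).
  have [c cE] := BD n m; have [d dE] := BD m n; exists (c ^+ n * d ^+ m).
  by rewrite /t exprD {1}cE addnC dE !exprMn mulrACA.
have [a aE] : exists a : nat -> R, forall n, t n.+1 = a n * t n.
  have /choice[a aE] : forall n, exists a, t n.+1 = a * t n.
    by move=> n; have [c cE] := tD n 1%N; exists (c * t 1%N); rewrite -addn1 cE mulrAC -mulrA.
  by exists a.
exists a, t; split=> // s s0; apply: contrapT => sn.
(* an ideal maximal among those containing s and missing every t n is prime *)
have [|J [Js Jt] Jmax] := @ideal_maximal R hR
    (fun J => J s /\ forall n, ~ J (t n)) (colon s 1).
  split=> [|n [c]]; first by exists 1; rewrite mulr1 mul1r.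
  by rewrite mulr1 => e; apply: sn; exists n, c.
have Jadd z : ~ J z -> exists n, add_principal J z (t n).
  move=> Jz; apply: contrapT => H; apply: Jz.
  apply: (Jmax (add_principal J z)); last exact: add_principal_gen.
    split=> [|n Jn]; first exact: add_principalS.
    by apply: H; exists n.
  by move=> w; exact: add_principalS.
have Jprime : prime_ideal J.
  split=> [|x y Jxy]; first by rewrite -[1]/(B 0%N ^+ 0); exact: Jt.
  apply: contrapT => /not_orP[/Jadd[n [[u c] /= Ju tn]] /Jadd[m [[v d] /= Jv tm]]].
  have [k kE] := tD n m; apply: (Jt (n + m)%N); rewrite kE; apply: idealM.
  rewrite tn tm mulrDl; apply: idealD; first by rewrite mulrC; exact: idealM.
  rewrite mulrDr; apply: idealD; first exact: idealM.
  by rewrite mulrACA; exact: idealM.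
have [n Jn] := bP J (conj Jprime (ex_intro2 _ _ s Js s0)).
apply: (Jt n.+1); rewrite /t /B big_ord_recr /= exprSr mulrA.
by apply: idealM.
Qed.

End Primes.
(** * Generators of the fraction field *)

Section FractionFieldGenerators.
Variable R : idomainType.
Hypothesis hR : dedekind R.
Notation K := (frac_module R).

Lemma countable_frac_sequence : countable (@nonzero_primes R) ->
  exists (a : nat -> R) (k : nat -> K), [/\ forall n, a n != 0, forall n, k n = a n *: k n.+1,
    forall n, k n <> 0 & forall z, exists n r, z = r *: k n].
Proof.
move=> /(cofinal_divisors hR)[a [t [t0 tS tP]]].
have tF n : FracField.tofrac (t n) != 0 by rewrite tofrac_eq0.
exists a, (fun n => (FracField.tofrac (t n))^-1); split.
- by move=> n; have := t0 n.+1; rewrite tS mulf_eq0 negb_or => /andP[].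
- move=> n; have := tF n.+1; rewrite frac_scaleE tS tofracM mulf_eq0 negb_or => /andP[a0 _].
  by rewrite invfM mulVKf.
- by move=> n /eqP; rewrite invr_eq0 (negbTE (tF n)).
- move=> z; have [[x y] /= y0 ->] := frac_exists z.
  have [n [c tn]] := tP y y0; exists n, (x * c).
  have := tF n; rewrite frac_scaleE tn !tofracM mulf_eq0 negb_or => /andP[c0 y0F].
  by rewrite invfM -!mulrA mulVKf.
Qed.

Lemma countable_primes_countably_generated :
  countable (@nonzero_primes R) -> countably_generated K.
Proof.
move=> /countable_frac_sequence[a [k [_ _ _ kP]]].
exists (k @` [set: nat]); split.
  exact: sub_countable (card_image_le k [set: nat]) _.
move=> m; have [n [r ->]] := kP m; exists [:: (r, k n)]; split.
  by move=> q; rewrite inE => /eqP -> /=; exists n.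
by rewrite big_seq1.
Qed.

(** If J is a nonzero prime and b is a nonzero element of J, write 1 / b as a
    combination of generators.  The product of their denominators is then a
    multiple of b, so one of the denominators is in J.  Each denominator is in
    countably many primes only. *)
Lemma countably_generated_countable_primes :
  countably_generated K -> countable (@nonzero_primes R).
Proof.
move=> [X [Xc Xgen]].
have /choice[den denP] : forall z : K, exists d, d != 0 /\ exists r, d *: z = frac_embed R r.
  by move=> z; have [[x y] /= y0 yz] := frac_moduleP z; exists y; split=> //; exists x.
have den_sum (s : seq (R * K)) : exists r,
    (\prod_(q <- s) den q.2) *: (\sum_(q <- s) q.1 *: q.2) = frac_embed R r.
  elim: s => [|q s [r rE]]; first by exists 0; rewrite !big_nil scaler0 linear0.
  have [r' r'E] := (denP q.2).2.
  exists ((\prod_(q <- s) den q.2 * q.1) *: (r' : R^o) + den q.2 *: (r : R^o)).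
  rewrite linearP linearZ -r'E -[in RHS]rE !big_cons scalerDr !scalerA.
  congr (_ *: _ + _); first by rewrite -mulrA mulrC.
  by rewrite -scalerA.
apply: (@countable_smallS _ _ (\bigcup_(x in X) [set J | nonzero_primes J /\ J (den x)])).
  move=> J JP; have [Jprime [b Jb b0]] := JP.
  have [z zE] := frac_module_divisible (frac_embed R 1) b0.
  have [s [sX zs]] := Xgen z.
  have [r rE] := den_sum s; rewrite -zs in rE.
  have De : \prod_(q <- s) den q.2 = (r : R) * (b : R).
    apply/eqP; rewrite -tofrac_eq; apply/eqP.
    have zE' : FracField.tofrac (b : R) * (z : {fraction R}) = FracField.tofrac 1 := zE.
    have rE' : FracField.tofrac (\prod_(q <- s) den q.2) * (z : {fraction R}) =
        FracField.tofrac (r : R) := rE.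
    by rewrite tofracM -rE' mulrAC -mulrA zE' tofrac1 mulr1.
  have [|q qs Jq] := prime_ideal_prod Jprime (s := s) (f := fun q => den q.2).
    by rewrite De; exact: idealM.
  by exists q.2 => //; exact: sX.
apply: bigcup_countable => // x _.
exact: (countable_primes_containing hR (denP x).1).
Qed.

End FractionFieldGenerators.

(** * Cotorsion limits over countable spectra *)

Section LimitCoordinates.
Variable R : comNzRingType.

(** The vanishing of lim^1 for surjective transition maps; for c = 0 it also
    gives points of the limit above a given y. *)
Lemma tower_path (I : nat -> lmodType R) (p : forall n, {linear I n.+1 -> I n}) :
  (forall n y, exists x, p n x = y) ->
  forall (c : forall n, I n) (y : I 0%N), exists x : forall n, I n,
    x 0%N = y /\ forall n, p n (x n.+1) = x n - c n.
Proof.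
move=> psurj c y.
have [l lE] := dependent_choice (fun n => dependent_choice (psurj n)).
pose x := fix x n : I n := if n is n'.+1 return I n then l n' (x n' - c n') else y.
by exists x; split=> // n; exact: lE.
Qed.

(** Induction on n through the tower without its first term, so as to avoid
    identifications between indices. *)
Lemma invlim_coord_surj n : forall (I : nat -> lmodType R) (p : forall n, {linear I n.+1 -> I n}),
  (forall n y, exists x, p n x = y) -> forall y, exists x : invlim p, Defs.coord x n = y.
Proof.
elim: n => [|n IH] I p psurj y.
  have [x [x0 xS]] := tower_path psurj (fun=> 0) y.
  have xP n : p n (x n.+1) = x n by rewrite xS subr0.
  by exists (InvLim xP).
have [x xE] := IH (fun n => I n.+1) (fun n => p n.+1) (fun n => psurj n.+1) y.
pose c k : I k := if k is k'.+1 return I k then Defs.coord x k' else p 0%N (Defs.coord x 0%N).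
have cP k : p k (c k.+1) = c k by case: k => [//|k]; exact: (Defs.coordP x k).
by exists (InvLim cP).
Qed.

Lemma coord0_leq (I : nat -> lmodType R) (p : forall n, {linear I n.+1 -> I n})
  (x : invlim p) m n : (n <= m)%N -> Defs.coord x m = 0 -> Defs.coord x n = 0.
Proof.
elim: m => [|m IH]; first by rewrite leqn0 => /eqP ->.
rewrite leq_eqVlt => /predU1P[-> //|nm] xm; apply: IH => //.
by rewrite -(Defs.coordP x m) xm linear0.
Qed.

End LimitCoordinates.

Section LimitCotorsion.
Variable R : idomainType.
Hypothesis hR : dedekind R.
Notation K := (frac_module R).

Section Solve.
Variables (I : nat -> lmodType R) (p : forall n, {linear I n.+1 -> I n}).
Hypothesis psurj : forall n y, exists x, p n x = y.
Hypothesis Idiv : forall n, divisible (I n).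
Variable a : nat -> R.
Hypothesis a0 : forall n, a n != 0.
Let L := invlim p.

(** The solution is the series x_m = sum_k a_m ... a_{k-1} u_k over k >= m, whose
    coordinate of index n is finite because u_k vanishes there for k >= n. *)
Lemma invlim_solve_null (u : nat -> L) : (forall m, Defs.coord (u m) m = 0) ->
  exists x : nat -> L, forall m, x m - a m *: x m.+1 = u m.
Proof.
move=> u0.
pose c m k := \prod_(m <= j < k) a j.
pose X m n : I n := \sum_(m <= k < n) c m k *: Defs.coord (u k) n.
have XP m n : p n (X m n.+1) = X m n.
  have pX : p n (X m n.+1) = \sum_(m <= k < n.+1) c m k *: Defs.coord (u k) n.
    rewrite linear_sum; apply: eq_bigr => k _.
    by rewrite linearZ -(Defs.coordP (u k) n).
  rewrite pX /X; case: (leqP m n) => [mn|nm].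
    by rewrite big_nat_recr //= u0 scaler0 addr0.
  by rewrite !big_geq // ltnW.
exists (fun m => InvLim (XP m)) => m; apply: invlim_eqP => n.
rewrite -[LHS]/(X m n - a m *: X m.+1 n) /X; case: (ltnP m n) => [mn|nm].
  rewrite big_ltn // /c big_geq // scale1r scaler_sumr -addrA -[RHS]addr0; congr (_ + _).
  apply/eqP; rewrite subr_eq0; apply/eqP; rewrite big_nat [RHS]big_nat.
  by apply: eq_bigr => k /andP[mk _]; rewrite scalerA -big_ltn.
rewrite !big_geq // ?(leqW nm) // scaler0 subrr; apply/esym.
exact: coord0_leq (u0 m).
Qed.

(** Replace x m by x m - w m, where the w m are chosen one after the other so
    that the new right-hand side of index m vanishes at coordinate m; this is
    possible since I m is divisible and L maps onto it. *)
Lemma invlim_solve (z : nat -> L) : exists x : nat -> L, forall m, x m - a m *: x m.+1 = z m.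
Proof.
have next m (w : L) : exists w' : L, Defs.coord (z m + w - a m *: w') m = 0.
  have [y yE] := Idiv (Defs.coord (z m + w) m) (a0 m).
  have [w' w'E] := invlim_coord_surj psurj y; exists w'.
  by rewrite -[LHS]/(Defs.coord (z m + w) m - a m *: Defs.coord w' m) w'E yE subrr.
have [l lE] := choice (fun mw : nat * L => next mw.1 mw.2).
pose w := fix w m : L := if m is m'.+1 then l (m', w m') else 0.
have [x xE] := @invlim_solve_null (fun m => z m + w m - a m *: w m.+1) (fun m => lE (m, w m)).
exists (fun m => x m - w m) => m.
rewrite scalerBr opprB (addrC (_ *: w _)) addrACA xE (addrC (- w m)) -(opprB (w m)).
by rewrite -(addrA (z m)) addrK.
Qed.

End Solve.

(** K is the colimit of the R k_n, free of rank one. *)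
Lemma frac_sequence_map (E : lmodType R) (a : nat -> R) (k : nat -> K) (y : nat -> E) :
  (forall n, k n = a n *: k n.+1) -> (forall n, k n <> 0) ->
  (forall z, exists n r, z = r *: k n) -> (forall n, y n = a n *: y n.+1) ->
  exists h : {linear K -> E}, forall n, h (k n) = y n.
Proof.
move=> kS k0 kP yS.
have kyD n d : exists c, k n = c *: k (d + n)%N /\ y n = c *: y (d + n)%N.
  elim: d => [|d [c [kE yE]]]; first by exists 1; rewrite !scale1r.
  by exists (c * a (d + n)%N); rewrite -!scalerA addSn -kS -yS.
have r0 n r : r *: k n = 0 -> r = 0.
  move=> rk; apply: contrapT => /eqP r_neq0; apply: (k0 n).
  exact: frac_module_torsion_free rk.
pose G z e := exists n r, z = r *: k n /\ e = r *: y n.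
have [|||h hG] := @linear_of_graph R K E G.
- move=> c _ _ _ _ [n [r [-> ->]]] [m [t [-> ->]]].
  have [b [knE ynE]] := kyD n m; have [b' [kmE ymE]] := kyD m n.
  exists (m + n)%N, (c * (r * b) + t * b').
  by rewrite knE ynE kmE ymE !(addnC n m) !scalerDl -!scalerA.
- by move=> e [n [r [/esym/r0 -> ->]]]; rewrite scale0r.
- by move=> z; have [n [r zE]] := kP z; exists (r *: y n), n, r.
exists h => n; have [m [r [kE ->]]] := hG (k n).
have [b [knE ynE]] := kyD n m; have [b' [kmE ymE]] := kyD m n.
rewrite (addnC n m) in kmE ymE; rewrite ynE ymE scalerA; congr (_ *: _).
by apply/subr0_eq/(r0 (m + n)%N); rewrite scalerBl -scalerA -kmE -knE -kE subrr.
Qed.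

(** V is a direct summand of K^(V), and lifting from a direct sum is done on each
    summand. *)
Lemma frac_lift (E E' V : lmodType R) (f : {linear E -> E'}) (g : {linear V -> E'}) :
  (forall g : {linear K -> E'}, exists h : {linear K -> E}, forall z, f (h z) = g z) ->
  torsion_free V -> divisible V ->
  exists h : {linear V -> E}, forall v, f (h v) = g v.
Proof.
move=> lift Vtf Vdiv; have [j j_inj] := torsion_free_embedding hR Vtf.
have [v|r rE] := divisible_extends hR (f := j) (g := idfun) Vdiv.
  by move=> /(linear_injective0 j_inj).
have H v : exists h : {linear K -> E}, forall z, f (h z) = g (r (delta v z)).
  exact: lift (g \o r \o delta v).
have [h hE] := choice H; have [S SE] := dsum_lift h.
exists (S \o j) => v; rewrite -[in RHS](rE v : r (j v) = v) /=.
pose fS : {linear dsum V K -> E'} := f \o S.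
pose gr : {linear dsum V K -> E'} := g \o r.
rewrite -[LHS]/(fS (j v)) -[RHS]/(gr (j v)); apply: dsum_ext => x z.
by rewrite /fS /gr /= SE hE.
Qed.

(** With E the product of the I n and f x = (x_n - p x_{n+1}), whose kernel is
    the limit, a lift of g : K -> E is a choice of preimages y_n of g k_n with
    y_n = a_n y_{n+1}.  Arbitrary preimages e_n miss this by elements z_n of the
    limit, and are corrected by a solution of x_n - a_n x_{n+1} = z_n. *)
Lemma classC_cotorsion (C : lmodType R) : countable (@nonzero_primes R) ->
  classC C -> cotorsion C.
Proof.
move=> /(countable_frac_sequence hR)[a [k [a0 kS k0 kP]]].
move=> /classC_retractP[I [p [Iinj psurj [s [r rs]]]]].
apply: cotorsion_retract rs _; apply: Matlis_cotorsion_cotorsion => //.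
have Idiv n : divisible (I n) by exact: injective_divisible.
pose E := pi_module I.
have i_lin : linear (fun x : invlim p => Defs.coord x : E) by [].
pose i : {linear invlim p -> E} := linear_map i_lin.
have f_lin : linear (fun x : E => (fun n => x n - p n (x n.+1)) : E).
  move=> c x y; apply: pi_eqP => n.
  rewrite !pi_addE !pi_scaleE linearP opprD addrACA.
  by rewrite -scalerBr.
pose f : {linear E -> E} := linear_map f_lin.
have i_inj : injective i.
  by move=> x y xy; apply: invlim_eqP => n; exact: (congr1 (fun u : E => u n) xy).
have i_exact : exact_at i f.
  move=> x; split=> [fx|[y <-]].
    have xP n : p n (x n.+1) = x n.
      by apply/esym/subr0_eq; exact: (congr1 (fun u : E => u n) fx).
    by exists (InvLim xP).
  apply: pi_eqP => n; rewrite -[LHS]/(Defs.coord y n - p n (Defs.coord y n.+1)).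
  by rewrite Defs.coordP subrr.
have f_surj y : exists x, f x = y.
  have [x [_ xS]] := tower_path psurj y 0; exists x; apply: pi_eqP => n.
  by rewrite -[LHS]/(x n - p n (x n.+1)) xS opprB addrC subrK.
exists E, E, i, f; split=> //; first exact: divisible_pi.
move=> V g Vtf Vdiv; apply: frac_lift => // {V Vtf Vdiv}g.
have [e eE] := choice (fun n => f_surj (g (k n))).
have /choice[z zE] : forall n, exists z, i z = a n *: e n.+1 - e n.
  move=> n; apply/i_exact.
  by rewrite linearB linearZ_LR !eE -linearZ_LR -kS subrr.
have [x xE] := invlim_solve psurj Idiv a0 z.
have [|h hE] := frac_sequence_map (y := fun n => e n + i (x n)) kS k0 kP.
  move=> n; have -> : x n = z n + a n *: x n.+1 by rewrite -xE subrK.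
  by rewrite linearD zE linearZ_LR scalerDr addrA addrCA subrr addr0.
exists h => w; have [n [c ->]] := kP w.
have fi y : f (i y) = 0 by apply/i_exact; exists y.
by rewrite (linearZ_LR h) hE (linearZ_LR f) (linearD f) fi addr0 eE -(linearZ_LR g).
Qed.

End LimitCotorsion.

(** * Uncountable spectra *)

Section Uncountable.
Variable R : idomainType.
Hypothesis hR : dedekind R.

(** If N, the elements of countable support in the product P of the R/p, is
    cotorsion, then P -> P / N has a section h.  Since P / N is divisible and p
    kills R/p, h = 0, so P = N and the element with all coordinates 1 has
    countable support. *)
Lemma cotorsion_countable_primes : (forall C : lmodType R, classC C -> cotorsion C) ->
  countable (@nonzero_primes R).
Proof.
move=> CC.
pose T := {J : ideal R | nonzero_primes J}.
pose M (J : T) : lmodType R := quot_module (sval J).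
have MJ (J : T) (a : R) (x : M J) : sval J a -> a *: x = 0.
  move=> Ja; have [r <-] := quot_pi_surj x; rewrite -linearZ; apply/quot_pi0.
  by rewrite /GRing.scale /= mulrC; exact: idealM.
pose P := pi_module M; pose F := countable_supports T.
pose small_pred (x : P) := F (supp x).
pose N : submodule P := Submodule (small_supp0 F M) (@small_suppP R T F M).
have containing (a : R) : a != 0 -> countable [set J : T | sval J a].
  move=> a0; have /countable_injP[g g_inj] := countable_primes_containing hR a0.
  apply/countable_injP; exists (g \o sval) => J J' /set_mem Ja /set_mem J'a e.
  have JJ' : sval J = sval J'.
    by apply: g_inj e; apply/mem_set; split=> //; exact: svalP.
  case: J J' JJ' {Ja J'a e} => [J JP] [J' J'P] /= JJ'.
  by case: _ / JJ' J'P => J'P; congr exist; exact: Prop_irrelevance.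
(* R/p is a field, so a acts invertibly unless it is in p *)
have inv_mod (J : T) (a : R) : ~ sval J a -> exists r, forall x : M J, r *: (a *: x) = x.
  move=> Ja; have [Jprime Jnz] := svalP J.
  have [[[j r] /= Jj jr]|H] := pselect (add_principal (sval J) a 1); last first.
    case: Ja; apply: (prime_maximal hR Jprime Jnz) H _ (add_principal_gen _ _) => z.
    exact: add_principalS.
  by exists r => x; rewrite scalerA -[RHS]scale1r jr scalerDl [j *: x]MJ // add0r.
have Ccot : cotorsion (sub_module N).
  apply: CC; apply: (@classC_cprod R T hR M) => J.
  have [_ [a Ja a0]] := svalP J.
  by apply/(Matlis_cotorsion_classC hR)/(bounded_Matlis_cotorsion a0) => x; exact: MJ.
pose V := quot_module N.
have Vtf : torsion_free V.
  move=> a v a0; have [x <-] := quot_pi_surj v; rewrite -linearZ => /quot_pi0 ax.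
  apply/quot_pi0; apply: countable_smallS (countable_smallU ax (containing a a0)) => J /= xJ.
  apply: contrapT => /not_orP[/contrapT axJ Ja]; apply: xJ.
  by have [r rE] := inv_mod J a Ja; rewrite -(rE (x J)) -[a *: x J]/((a *: x) J) axJ scaler0.
have Vdiv : divisible V.
  move=> a v a0; have [x <-] := quot_pi_surj v.
  have /dependent_choice[y yE] : forall J : T, exists y : M J, ~ sval J a -> a *: y = x J.
    move=> J; have [Ja|/inv_mod[r rE]] := pselect (sval J a); first by exists 0.
    by exists (r *: x J); rewrite scalerA mulrC -scalerA.
  exists (quot_pi N y); rewrite -linearZ; apply/subr0_eq; rewrite -linearB.
  apply/quot_pi0; apply: countable_smallS (containing a a0) => J /= xyJ.
  apply: contrapT => Ja; apply: xyJ.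
  by rewrite -[LHS]/(a *: y J - x J) yE // subrr.
(* the identity of P/N lifts to P *)
have se : short_exact (@subval _ _ N) (quot_pi N).
  split; [exact: subval_inj | move=> x | exact: quot_pi_surj].
  apply: iff_trans (quot_pi0 N x) _; split=> [Nx|[y <-]]; last exact: subvalP y.
  by exists (SubModule Nx).
have [h hE] := cotorsion_lift (idfun : {linear V -> V}) Ccot se
  (torsion_free_divisible_flat hR Vtf Vdiv).
have h0 v : h v = 0.
  apply: pi_eqP => J; have [_ [a Ja a0]] := svalP J; have [w <-] := Vdiv a v a0.
  by rewrite linearZ_LR pi_scaleE MJ.
pose one : P := fun J => quot_pi (sval J) 1.
have /quot_pi0 one_small : quot_pi N one = 0 by rewrite -[LHS]hE h0 linear0.
have Tc : countable [set: T].
  apply: countable_smallS one_small => J _ /quot_pi0.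
  by have [[J1 _] _] := svalP J.
apply: (@countable_smallS _ _ (sval @` [set: T])).
  by move=> J JP; exists (exist _ J JP).
exact: sub_countable (card_image_le _ _) Tc.
Qed.

End Uncountable.

Theorem proposition3p7 (R : idomainType) (hR : dedekind R) :
  ((forall C : lmodType R, classC C <-> cotorsion C) <->
     countable (Spec R)) /\
  (countable (Spec R) <-> countably_generated (frac_module R)) /\
  (forall C : lmodType R, cotorsion C -> classC C).
Proof.
split; [|split].
- rewrite countable_Spec; split=> [CC|Pc C].
    by apply: cotorsion_countable_primes => // C /CC.
  by split; [exact: classC_cotorsion | exact: cotorsion_classC].
- rewrite countable_Spec; split; first exact: countable_primes_countably_generated.
  exact: countably_generated_countable_primes.
- exact: cotorsion_classC.
Qed.
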